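(* Assume the following three conditions. (Smoothness of $f$) $\sup_{y:|y-x|\le h}|f(y)-f(x)|\le w(h)$ for any $h\le h_0$, where $w(h)=h^s\ell_w(h)$ with $0<s\le1$ and $\ell_w$ slowly varying; $w$ is increasing on $[0,h_0]$; and $w(h)\ge\delta_0(h/h_0)^2$ and $w(h)\le u_0$ for any $h\in[0,h_0]$. (Local behaviour of $P_X$) $P_X([x-h,x+h])=h^{\tau+1}\ell_X(h)$ for all $h\le h_0$, where $\tau\ge-1$ and $\ell_X$ is slowly varying. (Mixing) For some $\eta,\kappa>0$, the $\beta$-mixing coefficients of $(X_k)$ satisfy $\beta_q\le1/\Psi^{-1}(2q)$ for any $q\ge1$, where $\Psi(u)=\eta(\log u)^\kappa$ (geometric $\beta$-mixing) or $\Psi(u)=\eta u^\kappa$ (arithmetic $\beta$-mixing). On $\Omega_0=\{L(h_0)^{-1/2}\le w(h_0)\}$ let $H_w:=\min\{h\in(0,h_0]:(\psi(h)/L(h))^{1/2}\le w(h)\}$, and for $n$ large enough let $h_w:=\min\{h\in(0,h_0]:(\psi(h)/\mathbb EL(h))^{1/2}\le w(h)\}$. Then, if $(X_k)$ is geometrically $\beta$-mixing, or if it is arithmetically $\beta$-mixing with a constant $\kappa<2s/(\tau+1)$, we have, for $n$ large enough, $$\mathbb P\Big[\Big\{\frac{w(h_w)}4\le w(H_w)\le4w(h_w)\Big\}\cap\Omega_0\Big]\ge1-\varphi_n\qquad\text{and}\qquad\mathbb P[\Omega_0^\complement]=o(\varphi_n),$$ where in the geometrically $\beta$-mixing case $$\varphi_n=\exp\big(-C_1n^{\delta_1}\ell_1(1/n)\big),\qquad\delta_1=\frac{2s}{(2s+\tau+1)(\kappa+1)},$$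 and in the arithmetically $\beta$-mixing case $$\varphi_n=C_2n^{-\delta_2}\ell_2(1/n),\qquad\delta_2=\frac{2s}{2s+\tau+1}\Big(\frac1\kappa-\frac{\tau+1}{2s}\Big),$$ where $C_1,C_2$ are positive constants and $\ell_1,\ell_2$ are slowly varying functions that depend on $\eta,\kappa,\tau,s,\sigma$ and $\ell_X,\ell_w$.
   Context: Setting. $(X_k)_{k\ge0}$ (in $\mathbb R^d$) and $(Y_k)_{k\ge1}$ (in $\mathbb R$) are adapted to a filtration $(\mathscr F_k)$, with $Y_k=f(X_{k-1})+\varepsilon_k$, where $(\varepsilon_k)$ is an $(\mathscr F_k)$-martingale increment (conditionally integrable and centered given $\mathscr F_{k-1}$), and there are a known $\sigma>0$ and $\mu,\gamma>0$ with $\mathbb E[\exp(\mu\varepsilon_k^2/\sigma^2)\mid\mathscr F_{k-1}]\le\gamma$ for all $k\ge1$. One observes $(X_{k-1},Y_k)_{k=1}^n$. The sequence $(X_k)_{k\ge0}$ is strictly stationary, $P_X$ is the law of $X_0$, and $x\in\mathbb R^d$ is fixed. $[x-h,x+h]$ denotes $\{y:|y-x|\le h\}$, with $|\cdot|$ the Euclidean norm. Constants $h_0,b,\delta_0,u_0>0$ are fixed. A function $\ell:\mathbb R^+\to\mathbb R^+$ is slowly varying if it is continuous and $\lim_{h\to0^+}\ell(yh)/\ell(h)=1$ for all $y>0$. Parameters. $0<s\le1$ and $\tau\ge-1$ are real numbers, $\ell_w$ and $\ell_X$ are slowly varying functions, and $w(h):=h^s\ell_w(h)$. Mixing coefficients.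 Extend $(X_k)$ to a strictly stationary process indexed by $\mathbb Z$. The $\beta$-mixing coefficients are $$\beta_q=\frac12\sup\sum_{i=1}^I\sum_{j=1}^J\big|\mathbb P[U_i\cap V_j]-\mathbb P[U_i]\mathbb P[V_j]\big|,$$ the supremum being over all finite partitions $(U_i)$, $(V_j)$ of the underlying space that are measurable with respect to $\sigma(X_k:k\le0)$ and $\sigma(X_k:k\ge q)$ respectively. Bandwidths. $\psi(h)=1+b\log(h_0/h)$, $L(h)=\sigma^{-2}\sum_{k=1}^n\mathbf 1_{|X_{k-1}-x|\le h}$, $\Omega_0=\{L(h_0)^{-1/2}\le w(h_0)\}$. On $\Omega_0$, $$H_w:=\min\Big\{h\in(0,h_0]:\Big(\frac{\psi(h)}{L(h)}\Big)^{1/2}\le w(h)\Big\},$$ and, for $n$ large enough that $(\mathbb EL(h_0))^{-1/2}\le w(h_0)$, $$h_w:=\min\Big\{h\in(0,h_0]:\Big(\frac{\psi(h)}{\mathbb EL(h)}\Big)^{1/2}\le w(h)\Big\}.$$ Conventions: a quotient $\psi(h)/0$ is $+\infty$, and $2s/(\tau+1)=+\infty$ if $\tau=-1$. *)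

(* Defs.v *)
From HB Require Import structures.
From mathcomp Require Import all_boot all_order all_algebra.
From mathcomp Require Import all_classical all_reals all_analysis.
From mathcomp Require Import measurable_realfun.

Set Implicit Arguments.
Unset Strict Implicit.
Unset Printing Implicit Defensive.
Import Order.TTheory GRing.Theory Num.Theory.
Import numFieldNormedType.Exports.
Local Open Scope classical_set_scope.
Local Open Scope ring_scope.

(** The norm [`|.|] of the library on ['rV[R]_d] is the sup norm. *)
Definition enorm (R : realType) (d : nat) (v : 'rV[R]_d) : R :=
  Num.sqrt (\sum_(i < d) v 0 i ^+ 2).

Definition eball (R : realType) (d : nat) (x : 'rV[R]_d) (h : R)
  : set 'rV[R]_d := [set y | enorm (y - x) <= h].

Definition borel_rV (R : realType) (d : nat) : set (set 'rV[R]_d) :=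
  <<s [set A | open A] >>.

(** Here R^+ is ]0, +oo[: nothing is required at 0, so that powers of
    [log (1 / h)] near 0 are allowed. *)
Definition slowly_varying (R : realType) (l : R -> R) : Prop :=
  [/\ forall h : R, 0 < h -> 0 < l h,
      {within `]0, +oo[, continuous l} &
      forall y : R, 0 < y -> (fun h => l (y * h) / l h) @ 0^'+ --> (1 : R)].

Definition measurable_wrt (T U : Type) (G : set (set T)) (B : set (set U))
  (g : T -> U) : Prop := forall A, B A -> G (g @^-1` A).

Definition filtration (disp : measure_display) (T : measurableType disp)
  (F : nat -> set (set T)) : Prop :=
  [/\ forall k, sigma_algebra setT (F k),
      forall k, F k `<=` measurable &
      forall k, F k `<=` F k.+1].

Definition random_process (R : realType) (d : nat) (I : Type)
  (disp : measure_display) (T : measurableType disp)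
  (X : I -> T -> 'rV[R]_d) : Prop :=
  forall i, measurable_wrt measurable (@borel_rV R d) (X i).

Definition product_salgebra (R : realType) (d : nat) (I : Type)
  : set (set (I -> 'rV[R]_d)) :=
  <<s [set C | exists i B, borel_rV B /\ C = [set z | B (z i)] ] >>.

Definition same_law (R : realType) (d : nat) (I : Type)
  (disp : measure_display) (T : measurableType disp) (P : probability T R)
  (X : I -> T -> 'rV[R]_d)
  (disp' : measure_display) (T' : measurableType disp')
  (P' : probability T' R) (X' : I -> T' -> 'rV[R]_d) : Prop :=
  forall C, @product_salgebra R d I C ->
    P [set t | C (fun i => X i t)] = P' [set t | C (fun i => X' i t)].

Definition strictly_stationary (R : realType) (d : nat) (I : nmodType)
  (disp : measure_display) (T : measurableType disp) (P : probability T R)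
  (X : I -> T -> 'rV[R]_d) : Prop :=
  random_process X /\
  forall k : I, same_law P (fun i => X (i + k)) P X.

(** The extension to Z may live on another probability space: only its law
    is tied to that of [X]. *)
Definition stationary_extension (R : realType) (d : nat)
  (disp : measure_display) (T : measurableType disp) (P : probability T R)
  (X : nat -> T -> 'rV[R]_d)
  (disp' : measure_display) (T' : measurableType disp')
  (P' : probability T' R) (Z : int -> T' -> 'rV[R]_d) : Prop :=
  strictly_stationary P' Z /\ same_law P' (fun k : nat => Z k%:Z) P X.

Definition is_condexp_ge0 (R : realType)
  (disp : measure_display) (T : measurableType disp) (P : probability T R)
  (G : set (set T)) (Z W : T -> \bar R) : Prop :=
  [/\ forall t, (0 <= W t)%E,
      measurable_wrt G [set A : set (\bar R) | measurable A] W &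
      forall A, G A -> (\int[P]_(t in A) W t = \int[P]_(t in A) Z t)%E].

(** [Z] is conditionally integrable given [G] and [E[Z | G] = W] almost
    surely; [Z] need not be integrable. *)
Definition is_condexp (R : realType)
  (disp : measure_display) (T : measurableType disp) (P : probability T R)
  (G : set (set T)) (Z W : T -> R) : Prop :=
  exists Wp Wn : T -> \bar R,
    [/\ is_condexp_ge0 P G (EFin \o Z^\+) Wp,
        is_condexp_ge0 P G (EFin \o Z^\-) Wn &
        {ae P, forall t, [/\ (Wp t < +oo)%E, (Wn t < +oo)%E
                           & (W t)%:E = (Wp t - Wn t)%E]}].

Definition condexp_ge0_le (R : realType)
  (disp : measure_display) (T : measurableType disp) (P : probability T R)
  (G : set (set T)) (Z : T -> \bar R) (c : R) : Prop :=
  exists W, is_condexp_ge0 P G Z W /\ {ae P, forall t, (W t <= c%:E)%E}.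

Definition martingale_increment (R : realType)
  (disp : measure_display) (T : measurableType disp) (P : probability T R)
  (F : nat -> set (set T)) (eps : nat -> T -> R) : Prop :=
  forall k, measurable_wrt (F k.+1) [set A : set R | measurable A] (eps k.+1) /\
            is_condexp P (F k) (eps k.+1) (cst 0).

Definition generated_by (R : realType) (d : nat) (I T : Type)
  (Z : I -> T -> 'rV[R]_d) (D : set I) : set (set T) :=
  <<s [set A | exists i B, [/\ D i, borel_rV B & A = Z i @^-1` B]] >>.

Definition finite_partition (T : Type) (G : set (set T)) (m : nat)
  (U : 'I_m -> set T) : Prop :=
  [/\ forall i, G (U i), trivIset setT U & \bigcup_i U i = setT].

Definition beta_mixing (R : realType) (d : nat)
  (disp : measure_display) (T : measurableType disp) (P : probability T R)
  (Z : int -> T -> 'rV[R]_d) (q : nat) : \bar R :=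
  ((2^-1)%:E * ereal_sup [set r : \bar R |
     exists (m p : nat) (U : 'I_m -> set T) (V : 'I_p -> set T),
     [/\ finite_partition (generated_by Z [set k : int | (k <= 0)%R]) U,
         finite_partition (generated_by Z [set k : int | (q%:Z <= k)%R]) V &
         r = \sum_(i < m) \sum_(j < p)
               `|P (U i `&` V j) - P (U i) * P (V j)| ]])%E.

Variant mixing_type := geometric_mixing | arithmetic_mixing.

(** [Psi] is used on a domain where it is injective with range [0, +oo[
    or ]0, +oo[. *)
Definition Psi (R : realType) (m : mixing_type) (eta kappa u : R) : R :=
  match m with
  | geometric_mixing => eta * ln u `^ kappa
  | arithmetic_mixing => eta * u `^ kappa
  end.

Definition Psi_dom (R : realType) (m : mixing_type) : set R :=
  match m with
  | geometric_mixing => `[1, +oo[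
  | arithmetic_mixing => `]0, +oo[
  end.

Definition Psi_inv (R : realType) (m : mixing_type) (eta kappa : R) : R -> R :=
  pinv (@Psi_dom R m) (Psi m eta kappa).

Definition mixing (R : realType) (d : nat)
  (disp : measure_display) (T : measurableType disp) (P : probability T R)
  (Z : int -> T -> 'rV[R]_d) (m : mixing_type) (eta kappa : R) : Prop :=
  forall q : nat, (1 <= q)%N ->
    (beta_mixing P Z q <= ((Psi_inv m eta kappa (2 * q)%:R)^-1)%:E)%E.

Definition rate (R : realType) (s : R) (lw : R -> R) (h : R) : R :=
  h `^ s * lw h.

Definition psi (R : realType) (b h0 h : R) : R := 1 + b * ln (h0 / h).

Definition Lcount (R : realType) (d : nat) (T : Type)
  (X : nat -> T -> 'rV[R]_d) (x : 'rV[R]_d) (sigma : R) (n : nat) (h : R)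
  (t : T) : R :=
  sigma ^- 2 * \sum_(1 <= k < n.+1) \1_(eball x h) (X k.-1 t).

(** Quotients are taken in [\bar R], where [0^-1 = +oo]. *)
Definition Omega0 (R : realType) (T : Type) (L : R -> T -> R) (w : R -> R)
  (h0 : R) : set T :=
  [set t | (((L h0 t)%:E^-1) `^ 2^-1 <= (w h0)%:E)%E].

(** Equal to 0 when the minimum is not attained. *)
Definition set_min (R : realType) (A : set R) : R :=
  xget 0 [set h | A h /\ lbound A h].

Definition bandwidth (R : realType) (b h0 : R) (w : R -> R) (V : R -> \bar R)
  : R :=
  set_min [set h | 0 < h <= h0 /\
                   (((psi b h0 h)%:E / V h) `^ 2^-1 <= (w h)%:E)%E].

Definition random_bandwidth (R : realType) (T : Type) (b h0 : R) (w : R -> R)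
  (L : R -> T -> R) (t : T) : R :=
  bandwidth b h0 w (fun h => (L h t)%:E).

Definition mean_bandwidth (R : realType)
  (disp : measure_display) (T : measurableType disp) (P : probability T R)
  (b h0 : R) (w : R -> R) (L : R -> T -> R) : R :=
  bandwidth b h0 w (fun h => ('E_P[L h])%E).

Definition delta (R : realType) (m : mixing_type) (kappa tau s : R) : R :=
  match m with
  | geometric_mixing => 2 * s / ((2 * s + tau + 1) * (kappa + 1))
  | arithmetic_mixing =>
      2 * s / (2 * s + tau + 1) * (kappa^-1 - (tau + 1) / (2 * s))
  end.

Definition deviation (R : realType) (m : mixing_type) (dl C : R) (l : R -> R)
  (n : nat) : R :=
  match m with
  | geometric_mixing => expR (- (C * n%:R `^ dl * l n%:R^-1))
  | arithmetic_mixing => C * n%:R `^ (- dl) * l n%:R^-1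
  end.

(* Main.v *)
Require Import Defs.
From HB Require Import structures.
From mathcomp Require Import all_boot all_order all_algebra.
From mathcomp Require Import all_classical all_reals all_analysis.
From mathcomp Require Import measurable_realfun.
From mathcomp Require Import ring lra zify.

(** The set of bandwidths [h] with [psi h <= V h * w h ^+ 2] is an interval
    [[m, h0]], both for the count of visits [V = L] and for its mean.  Hence
    [w (H_w)] and [w (h_w)] are comparable as soon as the counts of visits to the
    two balls of radii [h_w / lam ^+ 2] and [lam * h_w], with [lam `^ s = 3 / 2],
    are within constant factors of their means, and [Omega_0] contains the event
    that the visits to the ball of radius [h0] are not too few.  For such a count,
    with mean [n * p], cut the time into blocks of length [q]: the blocks of
    one parity are independent up to an error of order [beta_q] per block, and
    Chernoff's bound gives
    [exp (- c * n * p / q) + (n / q) * beta_q], up to constants.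
    The length [q] balances the two terms when [n * p] is replaced by a lower bound
    [n * envelope n^-1], where [envelope] is regularly varying of index
    [(tau + 1) / (2 * s + tau + 1)] and depends only on [p] and [w]. *)

Set Implicit Arguments.
Unset Strict Implicit.
Unset Printing Implicit Defensive.
Import Order.TTheory GRing.Theory Num.Theory.
Import numFieldNormedType.Exports.
Local Open Scope classical_set_scope.
Local Open Scope ring_scope.

(** * Regular variation at 0 *)

Section RegularVariation.
Context {R : realType}.
Implicit Types (a b c u x y h e : R) (E : R -> R).

(** The slowly varying function of the rate has to be fixed before the process, [h0] and [b] are
    given, while [h_w] depends on [b] and [h0]. Hence the rate cannot be built from [p (h_w)];
    [envelope] uses [p] and [w] only, on some interval where both are monotone, and bounds [p (h_w)]
    from below up to a constant once [h_w], which tends to 0, has entered that interval.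
    Monotonicity also replaces uniform convergence theorems for regularly varying functions: limits
    at finitely many fixed ratios are enough, and monotonicity covers the points in between. The
    unknown constants (from [sigma], from Chernoff's bound, from the comparison of masses) are
    absorbed by powers of [1 + |ln u|] put into the rate. So every probability to be bounded is
    eventually below any prescribed multiple of [phi n]. This gives the bound by [phi n] itself with
    [C = 1], and the [o(phi n)] for the complement of [Omega_0]. *)

Definition regularly_varying a E : Prop :=
  [/\ forall u, 0 < u -> 0 < E u,
      forall u, 0 < u -> {for u, continuous E} &
      forall y, 0 < y -> (fun h => E (y * h) / E h) @ 0^'+ --> y `^ a].

Lemma powR_continuous_at a x : 0 < x -> {for x, continuous (@powR R ^~ a)}.
Proof.
move=> x0; apply: differentiable_continuous; apply/derivable1_diffP.
by apply: derivable_powR; rewrite in_itv/= x0.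
Qed.

Lemma slowly_varyingE E : slowly_varying E <-> regularly_varying 0 E.
Proof.
split=> -[E0 Ec El]; split=> //.
- move=> u u0; move: Ec; rewrite (continuous_open_subspace _ (rray_open (0 : R))).
  by apply; rewrite inE/= in_itv/= u0.
- by move=> y /El; rewrite powRr0.
- rewrite (continuous_open_subspace _ (rray_open (0 : R))).
  by move=> u; rewrite inE/= in_itv/= andbT; exact: Ec.
- by move=> y /El; rewrite powRr0.
Qed.

Lemma regularly_varyingM a b E E' : regularly_varying a E ->
  regularly_varying b E' -> regularly_varying (a + b) (fun u => E u * E' u).
Proof.
move=> [E0 Ec El] [E0' Ec' El']; split.
- by move=> u u0; rewrite mulr_gt0 ?E0 ?E0'.
- by move=> u u0; apply: continuousM; [exact: Ec|exact: Ec'].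
- move=> y y0; rewrite powRD; last by rewrite (gt_eqF y0) implybT.
  apply: cvg_trans (cvgM (El y y0) (El' y y0)); apply: near_eq_cvg.
  by near=> h; rewrite invfM mulrACA.
Unshelve. all: by end_near. Qed.

Lemma regularly_varyingX a c E : regularly_varying a E ->
  regularly_varying (a * c) (fun u => E u `^ c).
Proof.
move=> [E0 Ec El]; split.
- by move=> u u0; rewrite powR_gt0 ?E0.
- move=> u u0; apply: (@continuous_comp _ _ _ E (@powR R ^~ c)); first exact: Ec.
  by apply: powR_continuous_at; exact: E0.
- move=> y y0; rewrite powRrM.
  have H : (fun h => (E (y * h) / E h) `^ c) @ 0^'+ --> (y `^ a) `^ c := @continuous_cvg _ _ _ _ _ _ _ _ (powR_continuous_at (a := c) (powR_gt0 a y0)) (El y y0).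
  apply: cvg_trans (H _).
  apply: near_eq_cvg; near=> h.
  have h0 : 0 < h by near: h; exact: nbhs_right_gt.
  by rewrite powRM ?invr_ge0 ?ltW ?E0 ?mulr_gt0// -(powR_inv1 (ltW (E0 _ h0))) powRAC powR_inv1 ?powR_ge0.
Unshelve. all: by end_near. Qed.

Lemma regularly_varying_powR a : regularly_varying a (fun u : R => u `^ a).
Proof.
rewrite -[X in regularly_varying X]mul1r; apply: regularly_varyingX; split.
- by [].
- by move=> u _; exact: cvg_id.
- move=> y y0; rewrite powRr1 ?ltW//.
  apply: (@cvg_trans _ (y @[_ --> (0:R)^'+])); last exact: cvg_cst.
  apply: near_eq_cvg; near=> h.
  have h0 : 0 < h by near: h; exact: nbhs_right_gt.
  by rewrite mulfK// gt_eqF.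
Unshelve. all: by end_near. Qed.

(** The logarithmic factor used to absorb constants. The absolute value and the 1 keep it positive
    on all of []0, +oo[], as slow variation requires. *)
Definition one_add_abs_ln u := 1 + `|ln u|.

Lemma one_add_abs_ln_ge1 u : 1 <= one_add_abs_ln u.
Proof. by rewrite lerDl. Qed.

Lemma near0_one_add_abs_ln_ge c : \forall h \near (0:R)^'+, c <= one_add_abs_ln h.
Proof.
near=> h.
have h0 : 0 < h by near: h; exact: nbhs_right_gt.
have : h < expR (- `|c|) by near: h; apply: nbhs_right_lt; exact: expR_gt0.
rewrite -ltr_ln ?posrE ?expR_gt0// expRK => H.
rewrite /one_add_abs_ln; have := ler_norm c; have := ler_norm (- ln h); rewrite normrN.
lra.
Unshelve. all: by end_near. Qed.

(** Replacing [h] by [y * h] changes the value by at most [|ln y|], while the value itself is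
    unbounded at 0. *)
Lemma one_add_abs_ln_slow : regularly_varying 0 one_add_abs_ln.
Proof.
split.
- by move=> u _; apply: lt_le_trans (one_add_abs_ln_ge1 u).
- move=> u u0; apply: continuousD; first exact: cvg_cst.
  by apply: cvg_norm; exact: continuous_ln.
- move=> y y0; rewrite powRr0.
  apply/cvgrPdist_le => e e0; near=> h.
  have h0 : 0 < h by near: h; exact: nbhs_right_gt.
  have L0 : 0 < one_add_abs_ln h by apply: lt_le_trans (one_add_abs_ln_ge1 h).
  have : `|ln y| / e <= one_add_abs_ln h by near: h; exact: near0_one_add_abs_ln_ge.
  rewrite ler_pdivrMr// => H.
  rewrite -[X in X - _](divff (lt0r_neq0 L0)) -mulrBl normrM normfV (gtr0_norm L0) ler_pdivrMr// (mulrC e).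
  apply: le_trans H; rewrite /one_add_abs_ln opprD addrACA subrr add0r.
  apply: le_trans (ler_dist_dist _ _) _.
  by rewrite lnM// opprD addrCA subrr addr0 normrN.
Unshelve. all: by end_near. Qed.

(** A substitute for Potter's bounds: the limit at the single ratio [2^-1] gives a one-step
    inequality, and iterating it gives power behaviour along a dyadic sequence. *)
Lemma halving_iter (f : R -> R) (u0 th : R) : 0 < u0 -> 0 <= th ->
  (forall u, 0 < u <= u0 -> f (2^-1 * u) <= th * f u) ->
  forall k, f (2^-1 ^+ k * u0) <= th ^+ k * f u0.
Proof.
move=> u00 th0 H; elim=> [|k IH]; first by rewrite !expr0 !mul1r.
rewrite !exprS -!mulrA.
have k2 : 0 < (2^-1 : R) ^+ k by rewrite exprn_gt0// invr_gt0.
apply: le_trans (H _ _) _; last by rewrite ler_wpM2l.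
rewrite mulr_gt0//= -[leRHS]mul1r ler_wpM2r ?(ltW u00)//.
by rewrite exprn_ile1 ?invr_ge0 ?invf_le1 ?ler1n.
Qed.

End RegularVariation.

Lemma near0P {R : realType} (Q : R -> Prop) :
  (\forall h \near (0:R)^'+, Q h) <->
  exists2 d : R, 0 < d & forall h, 0 < h <= d -> Q h.
Proof.
split=> [|[d d0 H]].
- rewrite near_withinE => /nbhs_ballP[d /= d0 H].
  exists (d / 2); first by rewrite divr_gt0.
  move=> h /andP[h0 hd]; apply: H => //.
  by rewrite /ball/= sub0r normrN gtr0_norm//; lra.
- near=> h; apply: H; apply/andP; split; near: h.
  + exact: nbhs_right_gt.
  + exact: nbhs_right_le.
Unshelve. all: by end_near. Qed.

Lemma near0_scale {R : realType} (y : R) (Q : R -> Prop) : 0 < y ->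
  (\forall h \near (0:R)^'+, Q h) -> \forall h \near (0:R)^'+, Q (y * h).
Proof.
move=> y0 /near0P[d d0 H]; apply/near0P; exists (d / y); first exact: divr_gt0.
by move=> h /andP[h0]; rewrite ler_pdivlMr// => hd; apply: H; rewrite mulr_gt0//= mulrC.
Qed.

(** * The envelope of [p] and [w], and its regular variation *)

Section Envelope.
Context {R : realType}.
Implicit Types h u v y c e : R.
Context (p w : R -> R) (hs A s : R).
Hypotheses (hs0 : 0 < hs) (A0 : 0 <= A) (s0 : 0 < s)
  (p_gt0 : forall h, 0 < h <= hs -> 0 < p h)
  (w_gt0 : forall h, 0 < h <= hs -> 0 < w h)
  (p_le1 : forall h, 0 < h <= hs -> p h <= 1)
  (p_incr : forall h h', 0 < h -> h <= h' -> h' <= hs -> p h <= p h')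
  (w_incr : forall h h', 0 < h -> h <= h' -> h' <= hs -> w h <= w h')
  (p_rv : forall y, 0 < y -> (fun h => p (y * h) / p h) @ 0^'+ --> y `^ A)
  (w_rv : forall y, 0 < y -> (fun h => w (y * h) / w h) @ 0^'+ --> y `^ s).

(* Where [p h * w h ^+ 2] crosses the level [u], the supremum is the value of
   [p].  Regular variation of the generalized inverse of [p * w ^+ 2] is thus
   obtained without inverting anything. *)
Definition envelope u := sup [set Num.min (p h) (u / w h ^+ 2) | h in [set h | 0 < h <= hs]].

Lemma envelope_ub u h : 0 < h <= hs -> Num.min (p h) (u / w h ^+ 2) <= envelope u.
Proof.
move=> hh; apply: ub_le_sup; last by exists h.
by exists 1 => _ [h' hh' <-]; rewrite ge_min p_le1.
Qed.

Lemma envelope_le u c : (forall h, 0 < h <= hs -> Num.min (p h) (u / w h ^+ 2) <= c) ->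
  envelope u <= c.
Proof.
move=> H; apply: ge_sup; last by move=> _ [h hh <-]; exact: H.
by exists (Num.min (p hs) (u / w hs ^+ 2)), hs => //=; rewrite hs0 lexx.
Qed.

Lemma envelope_le1 u : envelope u <= 1.
Proof. by apply: envelope_le => h hh; rewrite ge_min p_le1. Qed.

Lemma envelope_gt0 u : 0 < u -> 0 < envelope u.
Proof.
move=> u0; have hh : 0 < hs <= hs by rewrite hs0 lexx.
apply: lt_le_trans (envelope_ub u hh).
by rewrite lt_min p_gt0//= divr_gt0// exprn_gt0// w_gt0.
Qed.

Lemma envelope_homo u v : u <= v -> envelope u <= envelope v.
Proof.
move=> uv; apply: envelope_le => h hh; apply: le_trans (envelope_ub v hh).
by rewrite le_min !ge_min lexx/= ler_wpM2r ?orbT// invr_ge0 exprn_ge0// ltW// w_gt0.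
Qed.

Lemma envelope_scale y u : 1 <= y -> 0 < u -> envelope (y * u) <= y * envelope u.
Proof.
move=> y1 u0; have y0 : 0 < y by apply: lt_le_trans y1.
apply: envelope_le => h hh.
rewrite -ler_pdivrMl//; apply: le_trans (envelope_ub u hh).
have ph := p_gt0 hh.
rewrite le_min -mulrA ler_pdivrMl// ge_min ler_peMl ?(ltW ph)//=.
by rewrite ler_pdivrMl// ge_min lexx orbT.
Qed.

(** Monotonicity gives the sign, [envelope_scale] with the ratio of the two points bounds the
    relative change, and [envelope <= 1] makes it an absolute one. This is the source of continuity,
    which a supremum does not inherit by itself. *)
Lemma envelope_lip u v : 0 < u -> 0 < v ->
  `|envelope v - envelope u| <= `|v - u| / u.
Proof.
move=> u0 v0; have E1 := envelope_le1 u; have E0 := envelope_gt0 u0.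
have [uv|/ltW vu] := leP u v.
- rewrite !ger0_norm ?subr_ge0 ?envelope_homo//.
  have y1 : 1 <= v / u by rewrite ler_pdivlMr// mul1r.
  have := envelope_scale y1 u0; rewrite divfK ?gt_eqF// => H.
  rewrite mulrBl divff ?gt_eqF//; nra.
- rewrite !ler0_norm ?subr_le0 ?envelope_homo// !opprB.
  have y1 : 1 <= u / v by rewrite ler_pdivlMr// mul1r.
  have := envelope_scale y1 v0; rewrite divfK ?gt_eqF//.
  rewrite mulrAC ler_pdivlMr// => H.
  rewrite ler_pdivlMr//; nra.
Qed.

Lemma envelope_continuous u : 0 < u -> {for u, continuous envelope}.
Proof.
move=> u0; apply/cvgrPdist_le => e e0; near=> v.
have v0 : 0 < v by near: v; exact: lt_nbhsr.
rewrite distrC; apply: le_trans (envelope_lip u0 v0) _.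
rewrite ler_pdivrMr// distrC; near: v.
by apply: cvgr_dist_le; [exact: cvg_id|exact: mulr_gt0].
Unshelve. all: by end_near. Qed.

Lemma regular_small e : 0 < e -> exists2 h, 0 < h <= hs & w h < e.
Proof.
move=> e0; have t1 : 2^-1 `^ s < 1 :> R.
  rewrite [ltRHS](_ : 1 = 1 `^ s); last by rewrite powR1.
  by rewrite gt0_ltr_powR ?nnegrE//; lra.
set t := 2^-1 `^ s in t1.
have t0 : 0 < t by rewrite powR_gt0 ?invr_gt0.
have th : t < (t + 1) / 2 by lra.
have /near0P[d d0 Hd] : \forall h \near (0:R)^'+, w (2^-1 * h) / w h <= (t + 1) / 2.
  by apply: cvgr_le th; apply: w_rv; rewrite invr_gt0.
pose u0 := Num.min d hs; have u00 : 0 < u0 by rewrite lt_min d0.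
have th0 : 0 <= (t + 1) / 2 by lra.
have u0s : u0 <= hs by rewrite ge_min lexx orbT.
have H k : w (2^-1 ^+ k * u0) <= ((t + 1) / 2) ^+ k * w u0.
  apply: halving_iter => // u /andP[uu uu0].
  rewrite -ler_pdivrMr; last by rewrite w_gt0// uu (le_trans uu0).
  by rewrite Hd// uu (le_trans uu0)// ge_min lexx.
have w0 : 0 < w u0 by rewrite w_gt0 ?u00.
have : \forall k \near \oo, ((t + 1) / 2) ^+ k * w u0 < e.
  have : (fun k => ((t + 1) / 2) ^+ k * w u0) @ \oo --> 0 * w u0.
    by apply: cvgMl; apply: cvg_expr; rewrite ger0_norm//; lra.
  by rewrite mul0r => /cvgr_lt; apply.
case=> k _ /(_ k (leqnn _)) /= Hk; exists (2^-1 ^+ k * u0).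
  have k2 : 0 < (2^-1 : R) ^+ k by rewrite exprn_gt0// invr_gt0.
  rewrite mulr_gt0//=; apply: le_trans u0s; rewrite -[leRHS]mul1r ler_wpM2r ?(ltW u00)//.
  by rewrite exprn_ile1 ?invr_ge0 ?invf_le1 ?ler1n.
exact: le_lt_trans (H k) Hk.
Qed.

(** Fix [h] with [w h] small: for [u] below [p h * w h ^+ 2] the minimum at [h] is [u / w h ^+ 2],
    so the quotient is at least [(w h) ^- 2]. *)
Lemma envelope_div_unbounded K : \forall u \near (0:R)^'+, K <= envelope u / u.
Proof.
pose c := Num.max K 1; have c0 : 0 < c by rewrite lt_max ltr01 orbT.
have [h hh wh] := @regular_small (Num.sqrt c^-1) ltac:(by rewrite sqrtr_gt0 invr_gt0).
have w0 := w_gt0 hh.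
have Hc : c <= (w h ^+ 2)^-1.
  rewrite -[c]invrK lef_pV2 ?posrE ?invr_gt0 ?exprn_gt0//.
  rewrite -[leRHS]sqr_sqrtr ?invr_ge0 ?(ltW c0)//.
  by rewrite ler_pXn2r ?nnegrE ?sqrtr_ge0// ltW.
apply/near0P; exists (p h * w h ^+ 2); first by rewrite mulr_gt0 ?exprn_gt0// p_gt0.
move=> u /andP[u0 uh]; rewrite ler_pdivlMr//.
apply: le_trans (envelope_ub u hh); rewrite min_r; last by rewrite ler_pdivrMr ?exprn_gt0.
rewrite mulrC ler_wpM2l ?(ltW u0)//; apply: le_trans Hc; by rewrite le_max lexx.
Qed.

(** For pure powers, [h]^ A[and]u * h [^ (- 2 * s)] cross at [h = u]^ (2 * s +
    A)^-1[, with common value]u [^ a]. *)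
Let a := A / (2 * s + A).

(* Substituting [h = l * h'] with [l = y `^ (2 * s + A)^-1] multiplies both
   arguments of the minimum by about [y `^ a]; large [h] do not matter because
   [envelope u / u] is unbounded. *)
Lemma envelope_scale_le y e : 0 < y -> 0 < e ->
  \forall u \near (0:R)^'+, envelope (y * u) <= (1 + e) * y `^ a * envelope u.
Proof.
move=> y0 e0.
have r0 : 0 < 2 * s + A by rewrite ltr_pwDl// mulr_gt0.
pose l := y `^ (2 * s + A)^-1.
have l0 : 0 < l by rewrite powR_gt0.
have lA : l `^ A = y `^ a by rewrite -powRrM mulrC.
have ls : y * (l `^ s) ^- 2 = y `^ a.
  rewrite -(powR_mulrn _ (powR_ge0 _ _)) -powRN -!powRrM -[X in X * _](powRr1 (ltW y0)).
  rewrite -powRD ?(gt_eqF y0) ?implybT//; congr (_ `^ _); rewrite /a; field; lra.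
have ya0 : 0 < y `^ a by rewrite powR_gt0.
have H1 : \forall h \near (0:R)^'+, p (l * h) / p h <= (1 + e) * y `^ a.
  by apply: (cvgr_le _ (p_rv l0)); rewrite lA; nra.
have H2 : \forall h \near (0:R)^'+, y * (w (l * h) / w h) ^- 2 <= (1 + e) * y `^ a.
  have H : (fun h => y * (w (l * h) / w h) ^- 2) @ 0^'+ --> y * (l `^ s) ^- 2.
    apply: cvgMr; apply: cvgV; first by rewrite sqrf_eq0 gt_eqF// powR_gt0.
    by rewrite expr2; under eq_fun do rewrite expr2; apply: cvgM; exact: w_rv.
  by apply: (cvgr_le _ H); rewrite ls; nra.
have /near0P[d d0 Hd] : \forall h \near (0:R)^'+,
    p (l * h) / p h <= (1 + e) * y `^ a /\ y * (w (l * h) / w h) ^- 2 <= (1 + e) * y `^ a.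
  by near=> h; split; near: h.
(* Up to [h1] the two ratio estimates hold, and both [h'] and [l * h'] stay in the domain []0,
   hs]]. *)
pose h1 := Num.min d (Num.min hs (hs / l)).
have h10 : 0 < h1 by rewrite !lt_min d0 hs0 divr_gt0.
have h1d : h1 <= d by rewrite ge_min lexx.
have h1s : h1 <= hs by rewrite !ge_min lexx orbT.
have h1l : l * h1 <= hs by rewrite mulrC -ler_pdivlMr// !ge_min lexx !orbT.
have hl1 : 0 < l * h1 by rewrite mulr_gt0.
have wl1 : 0 < w (l * h1) by rewrite w_gt0// hl1.
(* Beyond [l * h1] the second argument of the minimum is at most [y * u / w (l * h1) ^+ 2]; this [K]
   is what brings it below the target. *)
pose K := y / w (l * h1) ^+ 2 / ((1 + e) * y `^ a).
have ce0 : 0 < (1 + e) * y `^ a by rewrite mulr_gt0// addr_gt0.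
near=> u.
have u0 : 0 < u by near: u; exact: nbhs_right_gt.
have Ku : K <= envelope u / u by near: u; exact: envelope_div_unbounded.
apply: envelope_le => h /andP[hh0 hhs].
have [hl|/ltW hl] := leP h (l * h1); last first.
  rewrite ge_min; apply/orP; right.
  apply: (@le_trans _ _ (y * u / w (l * h1) ^+ 2)).
    rewrite ler_wpM2l ?mulr_ge0 ?(ltW y0) ?(ltW u0)//.
    rewrite lef_pV2 ?posrE ?exprn_gt0 ?w_gt0 ?hh0//.
    - by rewrite ler_pXn2r ?nnegrE ?(ltW wl1) ?w_incr// ltW// w_gt0// hh0.
    - by rewrite hl1.
  move: Ku; rewrite /K ler_pdivlMr// [leLHS]mulrAC ler_pdivrMr// => Ku.
  by rewrite mulrAC [leRHS]mulrC.
pose h' := h / l.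
have hE : h = l * h' by rewrite /h' mulrC divfK// gt_eqF.
have h'0 : 0 < h' by rewrite divr_gt0.
have h'1 : h' <= h1 by rewrite ler_pdivrMr// mulrC.
have hh' : 0 < h' <= hs by rewrite h'0 (le_trans h'1).
have [] := Hd h'; first by rewrite h'0 (le_trans h'1).
rewrite -hE ler_pdivrMr ?p_gt0// => P1 P2.
apply: (@le_trans _ _ ((1 + e) * y `^ a * Num.min (p h') (u / w h' ^+ 2))); last first.
  by rewrite ler_wpM2l ?(ltW ce0)// envelope_ub.
rewrite minr_pMr ?(ltW ce0)// le_min !ge_min P1/=; apply/orP; right.
have w'0 := w_gt0 hh'.
have wh0 : 0 < w h by rewrite w_gt0// hh0.
move: P2; rewrite expr_div_n invf_div mulrA ler_pdivrMr ?exprn_gt0// => P2.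
rewrite mulrA ler_pdivlMr ?exprn_gt0// mulrAC ler_pdivrMr ?exprn_gt0//.
by rewrite mulrAC [leRHS]mulrAC ler_wpM2r// ltW.
Unshelve. all: by end_near. Qed.

(** Only upper bounds are available, but the lower bound at ratio [y] is the upper bound at ratio
    [y^-1] taken at the point [y * u]. *)
Lemma envelope_regularly_varying : regularly_varying a envelope.
Proof.
split; [exact: envelope_gt0|exact: envelope_continuous|].
move=> y y0; apply/cvgrPdist_le => e e0.
have ya0 : 0 < y `^ a by rewrite powR_gt0.
pose e1 := e / y `^ a; have e10 : 0 < e1 by rewrite divr_gt0.
have y'0 : 0 < y^-1 by rewrite invr_gt0.
have H1 := envelope_scale_le y0 e10.
have H2 := near0_scale y0 (envelope_scale_le y'0 e10).
near=> u.
have u0 : 0 < u by near: u; exact: nbhs_right_gt.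
have E0 := envelope_gt0 u0.
have Ey0 := envelope_gt0 (mulr_gt0 y0 u0).
have h1 : envelope (y * u) <= (1 + e1) * y `^ a * envelope u by near: u.
have : envelope (y^-1 * (y * u)) <= (1 + e1) * y^-1 `^ a * envelope (y * u) by near: u.
rewrite mulKf ?gt_eqF// -(powR_inv1 (ltW y0)) powRAC powR_inv1 ?powR_ge0// => h2.
have ee : e1 * y `^ a = e by rewrite divfK// gt_eqF.
rewrite ler_norml; apply/andP; split.
  rewrite lerBrDl -lerBrDr ler_pdivrMr//; nra.
rewrite lerBlDr -lerBlDl ler_pdivlMr//.
move: h2; rewrite mulrAC ler_pdivlMr//; nra.
Unshelve. all: by end_near. Qed.

End Envelope.

Lemma near0_natV {R : realType} (Q : R -> Prop) :
  (\forall u \near (0:R)^'+, Q u) -> \forall n \near \oo, Q n%:R^-1.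
Proof.
move=> /near0P[d d0 H]; near=> n.
have n0 : (0 < n)%N by near: n; exact: nbhs_infty_gt.
apply: H; rewrite invr_gt0 ltr0n n0/=.
have : d^-1 <= n%:R by near: n; exact: nbhs_infty_ger.
by rewrite -{2}[d]invrK lef_pV2// posrE ?invr_gt0// ltr0n.
Unshelve. all: by end_near. Qed.

Lemma dyadic_bracket {R : realType} (d u : R) : 0 < u <= d ->
  exists k, d * 2^-1 ^+ k.+1 < u <= d * 2^-1 ^+ k.
Proof.
move=> /andP[u0 ud].
have ex : exists k, d * 2^-1 ^+ k.+1 < u.
  have : (fun k => d * 2^-1 ^+ k) @ \oo --> d * 0.
    by apply: cvgMr; apply: cvg_expr; rewrite ger0_norm//; lra.
  rewrite mulr0 => /cvgr_lt /(_ _ u0)[k _ /(_ k.+1 (leqnSn _)) /= H].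
  by exists k.
case: (ex_minnP ex) => -[|k] kP kmin; first by exists 0%N; rewrite kP expr0 mulr1.
exists k.+1; rewrite kP/= leNgt; apply/negP => /kmin; by rewrite ltnn.
Qed.

(** * Negative index: growth faster than any multiple of the logarithm *)

Section Growth.
Context {R : realType}.
Implicit Types u y r K : R.
Local Notation Lam := (@one_add_abs_ln R).

Lemma one_add_abs_ln_gt0 u : 0 < Lam u.
Proof. exact: lt_le_trans (one_add_abs_ln_ge1 u). Qed.

Lemma near0_lin_le_sqr K : \forall u \near (0:R)^'+, K * Lam u <= Lam u ^+ 2.
Proof.
near=> u; rewrite expr2 ler_wpM2r ?(ltW (one_add_abs_ln_gt0 u))//.
near: u; exact: near0_one_add_abs_ln_ge.
Unshelve. all: by end_near. Qed.

Lemma nonincreasing_regular_growth (F : R -> R) (b r K : R) : b < 0 -> 0 < r ->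
  regularly_varying b F ->
  (forall u y, 0 < u -> 1 <= y -> F (y * u) <= F u) ->
  \forall u \near (0:R)^'+, K * Lam u <= F u `^ r.
Proof.
move=> b0 r0 [F0 _ Fl] Fn.
have t1 : 1 < 2^-1 `^ b :> R.
  rewrite -[X in X `^ _]invrK -(powR_inv1) ?invr_ge0// -powRrM mulN1r invrK.
  rewrite [ltLHS](_ : 1 = 1 `^ (- b)); last by rewrite powR1.
  by rewrite gt0_ltr_powR ?oppr_gt0 ?nnegrE// ltr1n.
set t := 2^-1 `^ b in t1.
pose th := (t + 1) / 2.
have th1 : 1 < th by rewrite /th; lra.
have tht : th < t by rewrite /th; lra.
have th0 : 0 < th by lra.
have h2 : 0 < 2^-1 :> R by rewrite invr_gt0.
have /near0P[d d0 Hd] : \forall h \near (0:R)^'+, th <= F (2^-1 * h) / F h.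
  by apply: cvgr_ge tht; apply: Fl.
have Fk k : th ^+ k * F d <= F (2^-1 ^+ k * d).
  have := @halving_iter _ (fun u => (F u)^-1) d th^-1 d0.
  rewrite invr_ge0 (ltW th0) => /(_ isT) H.
  have F2 : 0 < F (2^-1 ^+ k * d) by rewrite F0 ?mulr_gt0 ?exprn_gt0.
  have F1 : 0 < th ^+ k * F d by rewrite mulr_gt0 ?exprn_gt0 ?F0.
  rewrite -lef_pV2 ?posrE// invfM -exprVn.
  apply: H => u ud; have u0 : 0 < u by case/andP: ud.
  have F3 : 0 < F (2^-1 * u) by rewrite F0 ?mulr_gt0.
  have F4 : 0 < th * F u by rewrite mulr_gt0 ?F0.
  by rewrite -invfM lef_pV2 ?posrE// -ler_pdivlMr ?F0// Hd.
pose beta := r * ln th; have beta0 : 0 < beta by rewrite mulr_gt0// ln_gt0.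
(* If [u] lies above [d * 2^-1 ^+ k.+1], then [|ln u|] is at most [|ln d| + (k + 1)], as
   [ln 2 <= 1]; the other 1 comes from [Lam]. *)
pose D := `|ln d| + 2.
pose c := F d `^ r * expR (- (beta * D)).
have c0 : 0 < c by rewrite mulr_gt0 ?expR_gt0 ?powR_gt0 ?F0.
have Fexp : \forall u \near (0:R)^'+, c * expR (beta * Lam u) <= F u `^ r.
  near=> u.
  have u0 : 0 < u by near: u; exact: nbhs_right_gt.
  have u1 : u <= 1 by near: u; apply: nbhs_right_le.
  have ud : u <= d by near: u; apply: nbhs_right_le.
  have [k /andP[k1 k2]] := @dyadic_bracket _ d u ltac:(by rewrite u0).
  have k0 : 0 < (2^-1 : R) ^+ k by rewrite exprn_gt0.
  have Fu : th ^+ k * F d <= F u.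
    apply: le_trans (Fk k) _; rewrite mulrC.
    have := Fn u ((d * 2^-1 ^+ k) / u) u0; rewrite divfK ?gt_eqF//; apply.
    by rewrite ler_pdivlMr// mul1r.
  have kL : Lam u - D <= k%:R.
    move: k1; rewrite -ltr_ln ?posrE ?mulr_gt0 ?exprn_gt0//.
    rewrite lnM ?posrE ?exprn_gt0// lnXn// lnV ?posrE// mulNrn.
    have l2 : ln 2 <= 1 :> R by have := @le_ln1Dx R 1 ltac:(lra); rewrite (_ : 1 + 1 = 2)//; lra.
    have l20 : 0 <= ln 2 :> R by rewrite ln_ge0// ler1n.
    have lu : ln u <= 0 by rewrite ln_le0.
    have ldu : ln u <= ln d by rewrite ler_ln.
    rewrite /one_add_abs_ln ler0_norm// /D -(mulr_natr (ln 2)) -(natr1 k).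
    have := ler_norm (- ln d); rewrite normrN.
    have := ler0n R k.
    nra.
  apply: (@le_trans _ _ ((th ^+ k * F d) `^ r)); last first.
    by rewrite ge0_ler_powR ?(ltW r0)// nnegrE ?ltW ?mulr_gt0 ?exprn_gt0 ?F0.
  rewrite powRM ?exprn_ge0 ?(ltW (F0 _ d0)) ?(ltW th0)// [leRHS]mulrC /c -mulrA -expRD -mulrN -mulrDr.
  apply: ler_wpM2l; first exact: powR_ge0.
  rewrite (_ : (th ^+ k) `^ r = expR (beta * k%:R)); last first.
    rewrite -(powR_mulrn _ (ltW th0)) -powRrM /powR gt_eqF//; congr expR.
    by rewrite /beta; ring.
  rewrite ler_expR ler_wpM2l ?(ltW beta0)//; lra.
near=> u.
have : c * expR (beta * Lam u) <= F u `^ r by near: u.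
apply: le_trans.
have H : K * 2 / (c * beta ^+ 2) * Lam u <= Lam u ^+ 2.
  by near: u; exact: near0_lin_le_sqr.
have bL : 0 <= beta * Lam u by rewrite mulr_ge0 ?(ltW beta0) ?(ltW (one_add_abs_ln_gt0 u)).
have := expR_ge1Dxn 1 bL; rewrite (_ : 2`! = 2)%N// => X.
have cb0 : 0 < c * beta ^+ 2 by rewrite (mulr_gt0 c0)// exprn_gt0.
move: H; rewrite mulrAC ler_pdivrMr// => H.
have := ler_wpM2l (ltW c0) X; apply: le_trans; clearbody c beta; lra.
Unshelve. all: by end_near. Qed.

End Growth.

Section PsiInverse.
Context {R : realType}.
Implicit Types eta kappa v : R.

Lemma Psi_inv_geometric eta kappa v : 0 < eta -> 0 < kappa -> 0 <= v ->
  Psi_inv geometric_mixing eta kappa v = expR ((v / eta) `^ kappa^-1).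
Proof.
move=> e0 k0 v0.
have ve : 0 <= v / eta by rewrite divr_ge0 ?(ltW e0).
have kn0 : kappa != 0 by rewrite gt_eqF.
have vE : v = Psi geometric_mixing eta kappa (expR ((v / eta) `^ kappa^-1)).
  by rewrite /Psi expRK -powRrM mulVf// powRr1// mulrC divfK// gt_eqF.
rewrite {1}vE /Psi_inv pinvKV//.
- move=> x y; rewrite !inE/= !in_itv/= !andbT => x1 y1 /(mulfI (lt0r_neq0 e0)) H.
  have := @powR_injective R kappa k0 (ln x) (ln y); rewrite !nnegrE !ln_ge0// => /(_ isT isT H).
  by apply: ln_inj; rewrite posrE (lt_le_trans _ x1, lt_le_trans _ y1).
- by rewrite inE/= in_itv/= andbT -[leLHS]expR0 ler_expR powR_ge0.
Qed.

Lemma Psi_inv_arithmetic eta kappa v : 0 < eta -> 0 < kappa -> 0 < v ->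
  Psi_inv arithmetic_mixing eta kappa v = (v / eta) `^ kappa^-1.
Proof.
move=> e0 k0 v0.
have ve : 0 < v / eta by rewrite divr_gt0.
have kn0 : kappa != 0 by rewrite gt_eqF.
have vE : v = Psi arithmetic_mixing eta kappa ((v / eta) `^ kappa^-1).
  by rewrite /Psi -powRrM mulVf// powRr1 ?(ltW ve)// mulrC divfK// gt_eqF.
rewrite {1}vE /Psi_inv pinvKV//.
- move=> x y; rewrite !inE/= !in_itv/= !andbT => x1 y1 /(mulfI (lt0r_neq0 e0)) H.
  by apply: (@powR_injective R kappa k0 x y _ _ H); rewrite nnegrE ltW.
- by rewrite inE/= in_itv/= andbT powR_gt0.
Qed.

End PsiInverse.

(** * Choice of the block length and the resulting rate *)

Section Rates.
Context {R : realType}.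
Implicit Types u y : R.
Local Notation Lam := (@one_add_abs_ln R).
Context (m : mixing_type) (eta kappa a : R) (E : R -> R).
Hypotheses (eta0 : 0 < eta) (kappa0 : 0 < kappa) (a1 : a < 1)
  (E_rv : regularly_varying a E) (E_le1 : forall u, E u <= 1)
  (E_scale : forall y u, 1 <= y -> 0 < u -> E (y * u) <= y * E u).

(** At [u = n^-1] this is [n * E n^-1], the proxy for the mean number of visits [n * p]. *)
Let F u := E u / u.

(** Geometric case: [q = F]^ (kappa / (kappa + 1))[equates the Chernoff exponent]F /
    q[with the mixing exponent]q [^ kappa^-1]. Arithmetic case: [F / q = Lam ^+ 2] makes the
    Chernoff term smaller than any power of [n^-1], at the price of logarithms only in the mixing
    term. *)
Definition block_scale u : R :=
  match m with
  | geometric_mixing => (E u / u) `^ (kappa / (kappa + 1))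
  | arithmetic_mixing => E u / u / one_add_abs_ln u ^+ 2
  end.

Definition block_length (n : nat) : nat := (Num.truncn (block_scale n%:R^-1)).+1.

Definition rate_exponent : R :=
  match m with
  | geometric_mixing => (1 - a) / (kappa + 1)
  | arithmetic_mixing => (1 - a) / kappa - a
  end.

(* Chosen so that the deviation rate is the one displayed in [deviationE]: the
   powers of [one_add_abs_ln] leave room for arbitrary constants. *)
Definition slow_factor u : R :=
  match m with
  | geometric_mixing =>
      u `^ rate_exponent * ((E u / u) `^ (kappa + 1)^-1 * (one_add_abs_ln u)^-1)
  | arithmetic_mixing =>
      u `^ (- rate_exponent) * ((E u)^-1 * (E u / u) `^ (- kappa^-1)
        * one_add_abs_ln u `^ (3 + 2 / kappa))
  end.

Lemma regularly_varyingV b (G : R -> R) : regularly_varying b G ->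
  regularly_varying (- b) (fun u => (G u)^-1).
Proof.
move=> [G0 Gc Gl]; split.
- by move=> u u0; rewrite invr_gt0 G0.
- by move=> u u0; apply: cvgV; [rewrite gt_eqF ?G0|exact: Gc].
- move=> y y0; rewrite powRN.
  have ya0 : y `^ b != 0 by rewrite gt_eqF// powR_gt0.
  apply: cvg_trans (cvgV ya0 (Gl y y0)); apply: near_eq_cvg.
  by near=> h; rewrite /unstable.inv_fun invf_div invrK mulrC.
Unshelve. all: by end_near. Qed.

Lemma ratio_rv : regularly_varying (a - 1) F.
Proof.
apply: regularly_varyingM => //; apply: regularly_varyingV.
have := @regularly_varying_powR R 1; rewrite /regularly_varying => -[H1 H2 H3]; split => //.
- by move=> u u0; exact: cvg_id.
- move=> y y0; apply: cvg_trans (H3 y y0); apply: near_eq_cvg; near=> h.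
  have h0 : 0 < h by near: h; exact: nbhs_right_gt.
  by rewrite !powRr1 ?mulr_ge0 ?ltW.
Unshelve. all: by end_near. Qed.

Lemma slow_factor_slow : slowly_varying slow_factor.
Proof.
apply/slowly_varyingE; rewrite /slow_factor /rate_exponent; case: m.
- have := regularly_varyingM (@regularly_varying_powR R ((1 - a) / (kappa + 1)))
    (regularly_varyingM (regularly_varyingX ((kappa + 1)^-1) ratio_rv)
       (regularly_varyingV (@one_add_abs_ln_slow R))).
  rewrite (_ : _ + _ = 0) ?oppr0 ?addr0 //.
  by rewrite -mulrDl addrC subrKA subrr mul0r.
- have := regularly_varyingM (@regularly_varying_powR R (- ((1 - a) / kappa - a)))
    (regularly_varyingM (regularly_varyingM (regularly_varyingV E_rv)
      (regularly_varyingX (- kappa^-1) ratio_rv))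
       (regularly_varyingX (3 + 2 / kappa) (@one_add_abs_ln_slow R))).
  rewrite [X in regularly_varying X _ -> _](_ : _ = 0)//; ring.
Qed.

Let phi (n : nat) := deviation m rate_exponent 1 slow_factor n.

Lemma deviationE n : (0 < n)%N -> let u := n%:R^-1 in
  phi n = match m with
  | geometric_mixing => expR (- (F u `^ (kappa + 1)^-1 / Lam u))
  | arithmetic_mixing => (E u)^-1 * F u `^ (- kappa^-1) * Lam u `^ (3 + 2 / kappa)
  end.
Proof.
move=> n0 u; have u0 : 0 < u by rewrite invr_gt0 ltr0n.
have nu : n%:R = u^-1 by rewrite invrK.
rewrite /phi /deviation /slow_factor /F; case: m; rewrite mul1r -/u nu mulrA.
- congr (expR (- _)).
  by rewrite -(@powRM R u^-1 u) ?invr_ge0 ?(ltW u0)// mulVf ?gt_eqF// powR1 mul1r.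
- by rewrite -(powR_inv1 (ltW u0)) -powRrM mulN1r -powRD ?addNr ?powRr0 ?mul1r// (gt_eqF u0) implybT.
Qed.

(** [E_scale] is exactly the monotonicity of [F], and its index [a - 1] is negative. *)
Lemma ratio_growth r K : 0 < r -> \forall u \near (0:R)^'+, K * Lam u <= F u `^ r.
Proof.
move=> r0; apply: (@nonincreasing_regular_growth _ F (a - 1)) => //.
- by rewrite subr_lt0.
- exact: ratio_rv.
- move=> u y u0 y1; have y0 : 0 < y by apply: lt_le_trans y1.
  rewrite /F ler_pdivrMr ?mulr_gt0// mulrCA -mulrA mulVf ?gt_eqF// mulr1.
  exact: E_scale.
Qed.

Lemma block_length_itv n : 0 <= block_scale n%:R^-1 ->
  block_scale n%:R^-1 <= (block_length n)%:R <= block_scale n%:R^-1 + 1.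
Proof.
by move=> /truncn_itv/andP[H1 H2]; rewrite /block_length (ltW H2)/= -natr1 lerD2r.
Qed.

Lemma block_error_small_geometric c e : m = geometric_mixing -> 0 < c -> 0 < e ->
  \forall n \near \oo,
    4 * expR (- (c * F n%:R^-1 / (block_length n)%:R))
    + 4 * ((n%:R / (block_length n)%:R + 1)
           * (2 / Psi_inv m eta kappa (2 * block_length n)%:R)) <= e * phi n.
Proof.
move=> mE c0 e0.
have k10 : 0 < kappa + 1 by rewrite addr_gt0.
pose c1 := c / 2; pose c2 := (2 / eta) `^ kappa^-1; pose c3 := Num.min c1 c2.
have c30 : 0 < c3 by rewrite lt_min divr_gt0 ?powR_gt0 ?divr_gt0.
(* The 20 is [4 + 4 * 4]: 4 from the Chernoff term, and 4 times the factor 4 of the bound on the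
   mixing term. *)
pose K := (`|ln (20 / e)| + 1) / (c3 / 2).
have P1 : \forall u \near (0:R)^'+, K * Lam u <= F u `^ (kappa + 1)^-1.
  by apply: ratio_growth; rewrite invr_gt0.
have P2 : \forall u \near (0:R)^'+, 1 * Lam u <= F u `^ (kappa / (kappa + 1)).
  by apply: ratio_growth; rewrite divr_gt0.
have P3 := @near0_one_add_abs_ln_ge R (2 / c3).
have P4 : \forall u \near (0:R)^'+, 0 < u <= 1.
  by apply/near0P; exists 1.
near=> n.
have N1 : K * Lam n%:R^-1 <= F n%:R^-1 `^ (kappa + 1)^-1 by near: n; exact: near0_natV P1.
have N2 : 1 * Lam n%:R^-1 <= F n%:R^-1 `^ (kappa / (kappa + 1)) by near: n; exact: near0_natV P2.
have N3 : 2 / c3 <= Lam n%:R^-1 by near: n; exact: near0_natV P3.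
have /andP[u0 u1] : 0 < (n%:R^-1 : R) <= 1 by near: n; exact: near0_natV P4.
set u : R := n%:R^-1 in N1 N2 N3 u0 u1 *.
have nu : n%:R = u^-1 by rewrite invrK.
have n0 : (0 < n)%N by rewrite -(ltr0n R) nu invr_gt0.
have n1 : 1 <= n%:R :> R by rewrite ler1n.
have F0 : 0 < F u by have [H _ _] := ratio_rv; exact: H.
have L1 := one_add_abs_ln_ge1 u.
rewrite (deviationE n0) -/u mE.
set b := F u `^ (kappa + 1)^-1 in N1 *.
have b0 : 0 < b by rewrite powR_gt0.
have SE : block_scale u = b `^ kappa.
  by rewrite /block_scale mE /b -powRrM (mulrC kappa).
have FE : F u = b * b `^ kappa.
  rewrite -[X in X * _](powRr1 (ltW b0)) -powRD ?(gt_eqF b0) ?implybT// addrC /b -powRrM.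
  by rewrite mulVf ?gt_eqF// powRr1 ?ltW.
have Q1 : 1 <= b `^ kappa.
  by rewrite -SE /block_scale mE; apply: le_trans N2; rewrite mul1r.
have := @block_length_itv n; rewrite -/u SE => /(_ (powR_ge0 _ _)) /andP[q1 q2].
set q := (block_length n)%:R in q1 q2 *.
have q0 : 0 < q by apply: lt_le_trans q1; apply: lt_le_trans Q1.
have T1 : expR (- (c * F u / q)) <= expR (- (c3 * b)).
  rewrite ler_expR lerN2 ler_pdivlMr// FE.
  have q2' : q <= 2 * b `^ kappa by lra.
  have c31 : c3 <= c1 by rewrite ge_min lexx.
  apply: (@le_trans _ _ (c1 * b * (2 * b `^ kappa))); last by rewrite /c1; lra.
  by rewrite ler_pM ?mulr_ge0 ?(ltW c30) ?(ltW b0) ?(ltW q0)// ler_pM2r.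
have T2 : (n%:R / q + 1) <= 2 * expR (Lam u).
  have nL : n%:R <= expR (Lam u).
    rewrite nu; apply: (@le_trans _ _ (expR (ln u^-1))).
      by rewrite lnK// posrE invr_gt0.
    rewrite ler_expR lnV ?posrE//.
    by have := ler_norm (- ln u); rewrite normrN /one_add_abs_ln; lra.
  have : n%:R / q <= n%:R by rewrite ler_piMr// invf_le1//; lra.
  lra.
have T3 : 2 / Psi_inv geometric_mixing eta kappa (2 * block_length n)%:R <= 2 * expR (- (c3 * b)).
  rewrite ler_wpM2l// Psi_inv_geometric// -expRN ler_expR lerN2.
  rewrite natrM -/q mulrAC powRM ?(ltW q0) ?divr_ge0 ?(ltW eta0)// -/c2.
  apply: ler_pM; rewrite ?(ltW c30) ?(ltW b0)//; first by rewrite ge_min lexx orbT.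
  rewrite -[leLHS](powRr1 (ltW b0)) -(mulfV (lt0r_neq0 kappa0)) powRrM.
  by rewrite ge0_ler_powR ?invr_ge0 ?(ltW kappa0)// nnegrE ?powR_ge0// ltW.
have EX : 1 <= expR (Lam u) by rewrite -[leLHS]expR0 ler_expR; lra.
have T4 : (n%:R / q + 1) * (2 / Psi_inv geometric_mixing eta kappa (2 * block_length n)%:R)
    <= 4 * expR (Lam u - c3 * b).
  apply: le_trans (ler_pM _ _ T2 T3) _.
  - by rewrite addr_ge0 ?divr_ge0 ?(ltW q0).
  - by rewrite divr_ge0// Psi_inv_geometric ?expR_ge0.
  - by rewrite (expRD (Lam u)) mulrACA -natrM.
have T5 : expR (- (c3 * b)) <= expR (Lam u - c3 * b) by rewrite ler_expR; lra.
apply: (@le_trans _ _ (20 * expR (Lam u - c3 * b))); first lra.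
have e20 : 0 < 20 / e by rewrite divr_gt0.
rewrite -ler_pdivrMl// mulrA (mulrC e^-1).
rewrite -[X in X * _](lnK e20) -expRD ler_expR.
have bL : b / Lam u <= c3 / 2 * b.
  rewrite ler_pdivrMr; last by lra.
  rewrite mulrAC ler_peMl ?(ltW b0)//.
  by move: N3; rewrite ler_pdivrMr//; lra.
have : (`|ln (20 / e)| + 1) * Lam u <= c3 / 2 * b.
  move: N1; rewrite /K mulrAC ler_pdivrMr; last by rewrite divr_gt0.
  by rewrite (mulrC b).
have := ler_norm (ln (20 / e)).
have : `|ln (20 / e)| <= `|ln (20 / e)| * Lam u by rewrite ler_peMr.
lra.
Unshelve. all: by end_near. Qed.

Lemma block_error_small_arithmetic c e : m = arithmetic_mixing -> 0 < c -> 0 < e ->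
  \forall n \near \oo,
    4 * expR (- (c * F n%:R^-1 / (block_length n)%:R))
    + 4 * ((n%:R / (block_length n)%:R + 1)
           * (2 / Psi_inv m eta kappa (2 * block_length n)%:R)) <= e * phi n.
Proof.
move=> mE c0 e0.
pose g := (2 / eta) `^ kappa^-1.
have g0 : 0 < g by rewrite powR_gt0 ?divr_gt0.
(* Lower bounds wanted on [Lam]: the second entry lets one spare factor [Lam] absorb the constant of
   the mixing term, the third puts the Chernoff term below [e / 2 * x]. Each error then takes half
   of [e]. *)
pose K := Num.max 2 (Num.max (32 / (g * e)) (2 * (`|ln (8 / e)| + kappa^-1) / c)).
have P1 : \forall u \near (0:R)^'+, 1 * Lam u <= F u `^ 2^-1.
  by apply: ratio_growth; rewrite invr_gt0.
have P3 := @near0_one_add_abs_ln_ge R K.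
have P4 : \forall u \near (0:R)^'+, 0 < u <= 1.
  by apply/near0P; exists 1.
near=> n.
have N1 : 1 * Lam n%:R^-1 <= F n%:R^-1 `^ 2^-1 by near: n; exact: near0_natV P1.
have N3 : K <= Lam n%:R^-1 by near: n; exact: near0_natV P3.
have /andP[u0 u1] : 0 < (n%:R^-1 : R) <= 1 by near: n; exact: near0_natV P4.
set u : R := n%:R^-1 in N1 N3 u0 u1 *.
have nu : n%:R = u^-1 by rewrite invrK.
have n0 : (0 < n)%N by rewrite -(ltr0n R) nu invr_gt0.
have F0 : 0 < F u by have [H _ _] := ratio_rv; exact: H.
have E0 : 0 < E u by have [H _ _] := E_rv; exact: H.
move: N3; rewrite !ge_max => /and3P[L2 L3 L4].
rewrite (deviationE n0) -/u mE.
have FE : F u = E u * n%:R by rewrite nu.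
have Fn : F u <= n%:R by rewrite FE ler_piMl.
have k'0 : 0 <= kappa^-1 by rewrite invr_ge0 ltW.
have LF : Lam u ^+ 2 <= F u.
  rewrite -[leRHS]sqr_sqrtr ?(ltW F0)// -powR12_sqrt ?(ltW F0)//.
  by move: N1; rewrite mul1r => N1; rewrite ler_pXn2r// nnegrE ?powR_ge0//; lra.
have nL : n%:R <= expR (Lam u).
  rewrite nu; apply: (@le_trans _ _ (expR (ln u^-1))).
    by rewrite lnK// posrE invr_gt0.
  rewrite ler_expR lnV ?posrE//.
  by have := ler_norm (- ln u); rewrite normrN /one_add_abs_ln; lra.
set l := Lam u in L2 L3 L4 LF nL *.
have l0 : 0 < l by lra.
have ll0 : 0 < l ^+ 2 by rewrite exprn_gt0.
have SE : block_scale u = F u / l ^+ 2 by rewrite /block_scale mE.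
have Q1 : 1 <= F u / l ^+ 2 by rewrite ler_pdivlMr// mul1r.
have Q0 : 0 < F u / l ^+ 2 by rewrite divr_gt0.
have := @block_length_itv n; rewrite -/u SE => /(_ (ltW Q0)) /andP[q1 q2].
set q := (block_length n)%:R in q1 q2 *.
have q0 : 0 < q by apply: lt_le_trans q1.
have q2' : q * l ^+ 2 <= 2 * F u.
  rewrite -ler_pdivlMr//; lra.
have T1 : expR (- (c * F u / q)) <= expR (- (c / 2 * l ^+ 2)).
  rewrite ler_expR lerN2 ler_pdivlMr//.
  have := ler_wpM2l (ltW c0) q2'; lra.
have nq : n%:R / q <= l ^+ 2 / E u.
  rewrite ler_pdivrMr// mulrAC ler_pdivlMr// mulrC -FE.
  by move: q1; rewrite ler_pdivrMr// mulrC.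
have T2 : n%:R / q + 1 <= 2 * (l ^+ 2 / E u).
  have : 1 <= l ^+ 2 / E u.
    rewrite ler_pdivlMr// mul1r; apply: le_trans (E_le1 u) _.
    by rewrite exprn_ege1//; lra.
  lra.
pose x := F u `^ (- kappa^-1).
have x0 : 0 < x by rewrite powR_gt0.
have T3 : 2 / Psi_inv arithmetic_mixing eta kappa (2 * block_length n)%:R
    <= 2 / g * (x * l `^ (2 / kappa)).
  rewrite Psi_inv_arithmetic// ?ltr0n// -mulrA ler_wpM2l//.
  rewrite natrM -/q mulrAC powRM ?(ltW q0) ?divr_ge0 ?(ltW eta0)// -/g invfM.
  rewrite ler_wpM2l ?invr_ge0 ?(ltW g0)//.
  rewrite /x powRN -[l `^ _]invrK -invfM lef_pV2 ?posrE ?mulr_gt0 ?invr_gt0 ?powR_gt0//.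
  rewrite powRrM powR_mulrn ?(ltW l0)// -(powR_inv1 (powR_ge0 _ _)) powRAC powR_inv1 ?(ltW ll0)//.
  rewrite -powRM ?(ltW F0) ?invr_ge0 ?(ltW ll0)//.
  by rewrite ge0_ler_powR// nnegrE ltW.
have l3 : l `^ (3 + 2 / kappa) = l ^+ 3 * l `^ (2 / kappa).
  by rewrite powRD ?(gt_eqF l0) ?implybT// powR_mulrn ?(ltW l0).
rewrite -/x l3.
have y1 : 1 <= l `^ (2 / kappa).
  by rewrite -[leLHS](powRr0 l) ler_powR ?divr_ge0 ?(ltW kappa0)//; lra.
set y := l `^ (2 / kappa) in T3 y1 *.
have Ei1 : 1 <= (E u)^-1 by rewrite invf_ge1.
have T4 : (n%:R / q + 1) * (2 / Psi_inv arithmetic_mixing eta kappa (2 * block_length n)%:R)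
    <= 4 / g * ((E u)^-1 * x * (l ^+ 2 * y)).
  apply: le_trans (ler_pM _ _ T2 T3) _.
  - by rewrite addr_ge0 ?divr_ge0 ?(ltW q0).
  - by rewrite divr_ge0// Psi_inv_arithmetic ?powR_ge0// ltr0n.
  - by rewrite le_eqVlt; apply/orP; left; apply/eqP; field; rewrite !gt_eqF.
set z := (E u)^-1 * x * (l ^+ 2 * y) in T4.
have z0 : 0 < z by rewrite /z !mulr_gt0 ?invr_gt0//; lra.
have zE : (E u)^-1 * x * (l ^+ 3 * y) = l * z by rewrite /z; ring.
rewrite zE; clearbody z.
have T5 : 16 / g * z <= e / 2 * (l * z).
  rewrite mulrA ler_wpM2r ?(ltW z0)// ler_pdivrMr//.
  move: L3; rewrite ler_pdivrMr ?mulr_gt0//; lra.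
have xe : expR (- (l / kappa)) <= x.
  rewrite /x powRN expRN lef_pV2 ?posrE ?expR_gt0 ?powR_gt0//.
  apply: (@le_trans _ _ (expR l `^ kappa^-1)).
    by rewrite ge0_ler_powR// ?nnegrE ?expR_ge0 ?(ltW F0)// (le_trans Fn).
  by rewrite /powR gt_eqF ?expR_gt0// expRK mulrC.
have T6 : 4 * expR (- (c / 2 * l ^+ 2)) <= e / 2 * x.
  have e8 : 0 < 8 / e by rewrite divr_gt0.
  apply: (@le_trans _ _ (e / 2 * expR (- (l / kappa)))); last by rewrite ler_wpM2l// divr_ge0 ?ltW.
  rewrite -ler_pdivrMl ?divr_gt0// mulrA (_ : (e / 2)^-1 * 4 = 8 / e); last by field; rewrite gt_eqF.
  rewrite -[X in X * _](lnK e8) -expRD ler_expR.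
  move: L4; rewrite ler_pdivrMr// => L4.
  have := ler_norm (ln (8 / e)).
  have : `|ln (8 / e)| <= `|ln (8 / e)| * l by rewrite ler_peMr//; lra.
  have := ler_wpM2r (ltW l0) L4; rewrite expr2; lra.
have T7 : x <= l * z.
  have lz : 1 <= l ^+ 3 * y by rewrite mulr_ege1// exprn_ege1//; lra.
  rewrite -zE mulrAC ler_peMl ?(ltW x0)// mulr_ege1//.
have T8 : e / 2 * x <= e / 2 * (l * z) by rewrite ler_wpM2l// divr_ge0 ?ltW.
lra.
Unshelve. all: by end_near. Qed.

End Rates.

(** * Counting visits to a ball *)

Section Balls.
Context {R : realType} {d : nat}.

Lemma enorm_continuous : continuous (@enorm R d).
Proof.
have H (s : seq 'I_d) : continuous (fun v : 'rV[R]_d => \sum_(i <- s) v 0 i ^+ 2).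
  elim: s => [|i s IH].
    rewrite (_ : (fun _ => _) = cst 0); first exact: cst_continuous.
    by apply/funext => v; rewrite big_nil.
  rewrite (_ : (fun _ => _) =
    ((fun v : 'rV[R]_d => v 0 i) \* (fun v => v 0 i)) \+ (fun v => \sum_(i <- s) v 0 i ^+ 2)); last first.
    by apply/funext => v; rewrite big_cons expr2.
  move=> v; apply: (@continuousD R R^o _ _ _ v); last exact: IH.
  exact: (@continuousM R _ _ _ v (@coord_continuous R 1 d 0 i v) (@coord_continuous R 1 d 0 i v)).
by move=> v; apply: (@continuous_comp _ _ _ _ (@Num.sqrt R)); [exact: H|exact: sqrt_continuous].
Qed.

Lemma eball_borel (x : 'rV[R]_d) h : borel_rV (eball x h).
Proof.
rewrite -[eball x h]setCK; apply: sigma_algebraC; apply: sub_sigma_algebra => /=.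
apply: closed_openC; rewrite (_ : eball x h = (fun y => enorm (y - x)) @^-1` [set z | z <= h])//.
apply: preimage_closed; last exact: closed_le.
move=> y _; apply: (@continuous_comp _ _ _ (fun y : 'rV[R]_d => y - x) (@enorm R d)).
  exact: (cvgB cvg_id (cvg_cst x)).
exact: enorm_continuous.
Qed.

End Balls.

Lemma generated_preimage (T T' : Type) (f : T -> T') (G : set (set T'))
    (H : set (set T)) : sigma_algebra setT H ->
  (forall C, G C -> H (f @^-1` C)) -> forall C, <<s G >> C -> H (f @^-1` C).
Proof.
move=> sH GH; have := @smallest_sub _ (sigma_algebra setT) G (image_set_system setT f H).
move=> S C GC; have := S _ _ C GC; rewrite /image_set_system/= setTI; apply.
- exact: sigma_algebra_image.
- by move=> D /GH; rewrite /image_set_system/= setTI.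
Qed.

(** A list of times accommodates blocks and their concatenations alike; values in [nat] make the
    level sets a finite partition, the form in which mixing is stated. *)
Definition visits (T U : Type) (A : set U) (X : nat -> T -> U) (s : seq nat) (t : T) : nat :=
  count (fun k => X k t \in A) s.

Lemma visits_cat (T U : Type) (A : set U) (X : nat -> T -> U) s1 s2 t :
  visits A X (s1 ++ s2) t = (visits A X s1 t + visits A X s2 t)%N.
Proof. exact: count_cat. Qed.

Lemma visits_le (T U : Type) (A : set U) (X : nat -> T -> U) s t :
  (visits A X s t < (size s).+1)%N.
Proof. by rewrite ltnS count_size. Qed.

Lemma measurable_visits d (T : measurableType d) (U : Type) (A : set U)
    (X : nat -> T -> U) s i :
  (forall k, (k \in s) -> measurable (X k @^-1` A)) ->
  measurable [set t | visits A X s t = i].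
Proof.
elim: s i => [|k s IH] i mX.
  rewrite /visits/=; case: (eqVneq 0%N i) => [<-|/eqP i0].
    by rewrite (_ : [set _ | _] = setT)//; apply/seteqP; split.
  by rewrite (_ : [set _ | _] = set0)//; apply/seteqP; split.
have mk : measurable (X k @^-1` A) by apply: mX; rewrite mem_head.
have ms j : measurable [set t | visits A X s t = j].
  by apply: IH => l ls; apply: mX; rewrite in_cons ls orbT.
rewrite (_ : [set t | _] = (X k @^-1` A `&` [set t | (visits A X s t).+1 = i]) `|`
   (~` (X k @^-1` A) `&` [set t | visits A X s t = i])).
  apply: measurableU; apply: measurableI => //; last exact: measurableC.
  case: i => [|i].
    by rewrite (_ : [set _ | _] = set0)//; apply/seteqP; split.
  rewrite (_ : [set t | _] = [set t | visits A X s t = i])//.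
  by apply/seteqP; split => t /=; [move=> []|move=> ->].
apply/seteqP; split => t; rewrite /visits/=.
- case: (boolP (X k t \in A)) => [/set_mem H|/negP H] <-; [by left|right; split=> // /mem_set//].
- case=> -[/= H <-]; first by rewrite (mem_set H).
  by case: (boolP (X k t \in A)) => // /set_mem.
Qed.

Section Probability.
Context {R : realType} {d : measure_display} {T : measurableType d} (P : probability T R).
Implicit Types (A D : set T).

Definition pr A : R := fine (P A).

Lemma prE A : measurable A -> P A = (pr A)%:E.
Proof. by move=> mA; rewrite /pr fineK// fin_num_measure. Qed.

Lemma pr_ge0 A : 0 <= pr A. Proof. exact: fine_ge0. Qed.

Lemma pr_le1 A : measurable A -> pr A <= 1.
Proof. by move=> mA; rewrite -lee_fin -prE// probability_le1. Qed.

Lemma pr_setT : pr setT = 1.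
Proof. by rewrite /pr probability_setT. Qed.

Lemma pr0 : pr set0 = 0. Proof. by rewrite /pr measure0. Qed.

Lemma pr_le A D : measurable A -> measurable D -> A `<=` D -> pr A <= pr D.
Proof. by move=> mA mD AD; rewrite -lee_fin -!prE// le_measure// inE. Qed.

Lemma pr_setU_le A D : measurable A -> measurable D -> pr (A `|` D) <= pr A + pr D.
Proof.
move=> mA mD; rewrite -lee_fin EFinD -!prE//; last exact: measurableU.
exact: measureU2.
Qed.

Lemma pr_setC A : measurable A -> pr (~` A) = 1 - pr A.
Proof.
move=> mA; have := @probability_setC _ _ _ P A mA.
by rewrite !prE//; [move=> [->]|exact: measurableC].
Qed.

Lemma pr_partition (c : T -> nat) K D : (forall i, measurable [set t | c t = i]) ->
  measurable D -> (forall t, (c t < K)%N) ->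
  pr D = \sum_(i < K) pr (D `&` [set t | c t = i]).
Proof.
move=> mc mD cK.
have mlt k : measurable [set t | (c t < k)%N].
  elim: k => [|k IH]; first by rewrite (_ : [set _ | _] = set0)//; apply/seteqP; split.
  rewrite (_ : [set t | _] = [set t | (c t < k)%N] `|` [set t | c t = k]); first exact: measurableU.
  apply/seteqP; split => t /=; rewrite ltnS.
    by rewrite leq_eqVlt => /orP[/eqP|]; [right|left].
  by case=> [/ltnW//|->].
have -> : pr D = pr (D `&` [set t | (c t < K)%N]).
  congr pr; apply/seteqP; split => [t Dt|t []//]; by split=> //=.

elim: {cK} K => [|k IH].
  by rewrite big_ord0 (_ : _ `&` _ = set0) ?pr0//; apply/seteqP; split => t [].
rewrite big_ord_recr/= -IH.
have m1 : measurable (D `&` [set t | (c t < k)%N]) by apply: measurableI.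
have m2 : measurable (D `&` [set t | c t = k]) by apply: measurableI.
apply/EFin_inj; rewrite EFinD -!prE//; last by apply: measurableI.
rewrite -measureU//.
  congr (P _); apply/seteqP; split => t /=; rewrite ltnS.
    by rewrite leq_eqVlt => -[Dt /orP[/eqP|]]; [right|left].
  by case=> -[Dt]; [move=> /ltnW|move=> ->].
by apply/seteqP; split => t //= -[[_ +] [_ tk]]; rewrite tk ltnn.
Qed.

End Probability.

Lemma expR_chord {R : realType} (th x : R) : 0 <= x <= 1 ->
  expR (th * x) <= 1 + x * (expR th - 1).
Proof.
(* The convex combination of the tangent bounds at the two end points. *)
move=> /andP[x0 x1]; set c := expR (th * x).
have c0 : 0 < c by exact: expR_gt0.
have h1 : c * (1 + th * (1 - x)) <= expR th.
  rewrite (_ : expR th = c * expR (th * (1 - x))); last by rewrite /c -expRD; congr expR; ring.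
  by rewrite ler_wpM2l ?(ltW c0)// expR_ge1Dx.
have h2 : c * (1 - th * x) <= 1.
  rewrite [leRHS](_ : 1 = c * expR (- (th * x))); last by rewrite /c -expRD subrr expR0.
  by rewrite ler_wpM2l ?(ltW c0)// expR_ge1Dx.
have := ler_wpM2l x0 h1; have x10 : 0 <= 1 - x by lra.
have := ler_wpM2l x10 h2; lra.
Qed.

(** * Mean and exponential moment of a count *)

Section Visits.
Context {R : realType} {d : measure_display} {T : measurableType d} (P : probability T R).
Context (U : Type) (A : set U) (X : nat -> T -> U).
Hypothesis mX : forall k, measurable (X k @^-1` A).

Local Notation pr := (pr P).
Local Notation V := (visits A X).

Lemma integral_sum_indic (I : Type) (a : I -> R) (E : I -> set T) (s : seq I) :
  (forall k, 0 <= a k) -> (forall k, measurable (E k)) ->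
  (\int[P]_t (\sum_(k <- s) a k * \1_(E k) t)%:E = (\sum_(k <- s) a k * pr (E k))%:E)%E.
Proof.
move=> a0 mE; under eq_integral do rewrite -sumEFin.
rewrite ge0_integral_sum//.
- rewrite -sumEFin; apply: eq_bigr => k _; rewrite EFinM -prE//.
  under eq_integral do rewrite EFinM.
  rewrite ge0_integralZl_EFin//.
  + by rewrite integral_indic// setIT.
  + by apply/measurable_EFinP; exact: measurable_indic.
- by move=> k; apply/measurable_EFinP; apply: measurable_funM; [exact: measurable_cst|exact: measurable_indic].
- by move=> k t _; rewrite lee_fin mulr_ge0.
Qed.

Let mV s i : measurable [set t | V s t = i].
Proof. by apply: measurable_visits. Qed.

Lemma visitsE s t : (V s t)%:R = \sum_(k <- s) \1_(X k @^-1` A) t :> R.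
Proof.
rewrite /visits; elim: s => [|k s IH]; first by rewrite big_nil.
rewrite big_cons /= natrD IH; congr (_ + _); rewrite indicE; congr (_ %:R).

Qed.

Lemma visits_mean s :
  \sum_(v < (size s).+1) v%:R * pr [set t | V s t = v] = \sum_(k <- s) pr (X k @^-1` A).
Proof.
apply/EFin_inj.
rewrite -(@integral_sum_indic _ (fun v : 'I_(size s).+1 => v%:R) (fun v => [set t | V s t = v]))//.
have := @integral_sum_indic _ (fun _ => 1) (fun k => X k @^-1` A) s.
rewrite (eq_bigr (fun k => pr (X k @^-1` A))); last by move=> k _; rewrite mul1r.
move=> <-//; apply: eq_integral => t _; congr EFin.
rewrite [RHS](eq_bigr (fun k => \1_(X k @^-1` A) t)); last by move=> k _; rewrite mul1r.
rewrite -visitsE (bigD1 (Ordinal (visits_le A X s t)))//= indicE mem_set// mulr1.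
rewrite big1 ?addr0// => v vN; rewrite indicE memNset ?mulr0// => /= Vv.
by move/eqP: vN; apply; apply: val_inj.
Qed.

Lemma visits_total s : \sum_(v < (size s).+1) pr [set t | V s t = v] = 1.
Proof.
rewrite -(pr_setT P) (@pr_partition _ _ _ P (V s) (size s).+1 setT)//; last exact: visits_le.
by apply: eq_bigr => v _; rewrite setTI.
Qed.

(** A count divided by [q] lies in [[0, 1]], where the chord bounds the exponential by an affine
    function; so the mean alone controls the moment, whatever the dependence inside the block. *)
Lemma visits_moment s (q th : R) : 0 < q -> (size s)%:R <= q ->
  \sum_(v < (size s).+1) pr [set t | V s t = v] * expR (th / q * v%:R)
  <= expR ((expR th - 1) / q * \sum_(k <- s) pr (X k @^-1` A)).
Proof.
move=> q0 sq; rewrite -visits_mean.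
apply: le_trans (expR_ge1Dx _); rewrite -[X in X + _](visits_total s) mulr_sumr -big_split/=.
apply: ler_sum => v _.
have vq : 0 <= v%:R / q <= 1.
  rewrite divr_ge0 ?(ltW q0)//= ler_pdivrMr// mul1r (le_trans _ sq)// ler_nat.
  by rewrite -ltnS ltn_ord.
rewrite (mulrAC th) -(mulrA th).
have := ler_wpM2l (pr_ge0 P [set t | V s t = v]) (expR_chord th vq).
move=> /le_trans; apply; lra.
Qed.

End Visits.

(** * Chernoff's bound for almost independent blocks *)

Section Chernoff.
Context {R : realType} {d : measure_display} {T : measurableType d} (P : probability T R).
Context (U : Type) (A : set U) (X : nat -> T -> U).
Hypothesis mX : forall k, measurable (X k @^-1` A).

Local Notation pr := (pr P).
Local Notation V := (visits A X).

Let mV s i : measurable [set t | V s t = i].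
Proof. by apply: measurable_visits. Qed.

Lemma measurable_visits_pred s (Q : pred nat) : measurable [set t | Q (V s t)].
Proof.
rewrite (_ : [set t | _] = \bigcup_(i in [set i | Q i]) [set t | V s t = i]).
  by apply: bigcup_measurable => i _.
apply/seteqP; split => t /=; first by exists (V s t).
by case=> i /= Qi ->.
Qed.

Lemma pr_visits_pred s (Q : pred nat) :
  pr [set t | Q (V s t)] = \sum_(i < (size s).+1) (Q i)%:R * pr [set t | V s t = i].
Proof.
rewrite (@pr_partition _ _ _ P (V s) (size s).+1)//; first last.
- exact: visits_le.
- exact: measurable_visits_pred.
apply: eq_bigr => i _; case: (boolP (Q i)) => [Qi|nQi]; rewrite ?mul1r ?mul0r.
  by congr pr; apply/seteqP; split => [t []|t /= Vi]//; rewrite Vi.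
rewrite -[RHS](pr0 P); congr pr; apply/seteqP; split => // t /= [+ Vi].
by rewrite Vi; exact/negP.
Qed.

Lemma pr_visits_pred2 s1 s2 (Q : nat -> nat -> bool) :
  pr [set t | Q (V s1 t) (V s2 t)] =
  \sum_(i < (size s1).+1) \sum_(j < (size s2).+1)
     (Q i j)%:R * pr ([set t | V s1 t = i] `&` [set t | V s2 t = j]).
Proof.
have mQ : measurable [set t | Q (V s1 t) (V s2 t)].
  rewrite (_ : [set t | _] = \bigcup_i ([set t | V s1 t = i] `&` [set t | Q i (V s2 t)])).
    by apply: bigcup_measurable => i _; apply: measurableI => //; exact: measurable_visits_pred.
  apply/seteqP; split => t /=; first by exists (V s1 t).
  by case=> i _ /= [->].
rewrite (@pr_partition _ _ _ P (V s1) (size s1).+1)//; last exact: visits_le.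
apply: eq_bigr => i _.
rewrite (@pr_partition _ _ _ P (V s2) (size s2).+1)//; [|exact: measurableI|exact: visits_le].
apply: eq_bigr => j _; case: (boolP (Q i j)) => [Qi|nQi]; rewrite ?mul1r ?mul0r.
  by congr pr; apply/seteqP; split => [t [[]]|t /= [Vi Vj]]//; rewrite Vi Vj.
rewrite -[RHS](pr0 P); congr pr; apply/seteqP; split => // t /= [[+ Vi] Vj].
by rewrite Vi Vj; exact/negP.
Qed.

(* [m0] is an integer because the first block may start at time 0, in which
   case the empty past has to end at time [-q]. *)
Definition decoupled (q : nat) (eps : R) := forall (m0 : int) (s1 s2 : seq nat),
  all (fun k => k%:Z <= m0) s1 -> all (fun k => m0 + q%:Z <= k%:Z) s2 ->
  \sum_(i < (size s1).+1) \sum_(j < (size s2).+1)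
    `|pr ([set t | V s1 t = i] `&` [set t | V s2 t = j])
      - pr [set t | V s1 t = i] * pr [set t | V s2 t = j]| <= eps.

(* Splitting according to the values of the past count and of the new block
   count costs [eps] per block and replaces the joint law by the product. *)
Lemma chernoff_blocks (q : nat) (eps lam : R) (b : nat -> seq nat) (M : nat -> R) N tt :
  decoupled q eps -> 0 <= eps ->
  (forall n, exists m0 : int, all (fun k => k%:Z <= m0) (flatten (mkseq b n)) /\
                        all (fun k => m0 + q%:Z <= k%:Z) (b n)) ->
  (forall n, \sum_(v < (size (b n)).+1) pr [set t | V (b n) t = v] * expR (lam * v%:R) <= M n) ->
  pr [set t | tt <= lam * (V (flatten (mkseq b N)) t)%:R]
    <= expR (- tt) * \prod_(j < N) M j + N%:R * eps.
Proof.
move=> dec eps0 gap Mb; elim: N tt => [|N IH] tt.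
  rewrite big_ord0 mulr1 mul0r addr0 /= /visits/= mulr0.
  have [t0|t0] := leP tt 0.
    rewrite (_ : [set _ | _] = setT); last by apply/seteqP; split.
    by rewrite pr_setT -[leLHS]expR0 ler_expR oppr_ge0.
  rewrite (_ : [set _ | _] = set0); last by apply/seteqP; split.
  by rewrite pr0 expR_ge0.
set s1 := flatten (mkseq b N) in IH *.
have -> : flatten (mkseq b N.+1) = s1 ++ b N by rewrite mkseqS flatten_rcons.
set s2 := b N.
have -> : [set t | tt <= lam * (V (s1 ++ s2) t)%:R] =
    [set t | (fun i j => tt <= lam * (i + j)%N%:R) (V s1 t) (V s2 t)].
  by apply/seteqP; split => t /=; rewrite visits_cat.
rewrite (pr_visits_pred2 s1 s2 (fun i j => tt <= lam * (i + j)%N%:R)).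
have [m0 [g1 g2]] := gap N.
have D := dec m0 s1 s2 g1 g2.
pose p1 (i : nat) := pr [set t | V s1 t = i].
pose p2 (j : nat) := pr [set t | V s2 t = j].
apply: (@le_trans _ _ (\sum_(i < (size s1).+1) \sum_(j < (size s2).+1)
   (tt <= lam * (i + j)%N%:R)%R%:R * (p1 i * p2 j) + eps)).
  rewrite -lerBlDl; apply: le_trans D; rewrite lerBlDl.
  rewrite -big_split/=; apply: ler_sum => i _; rewrite -big_split/=; apply: ler_sum => j _.
  rewrite -lerBlDl -mulrBr; case: (tt <= _).
    by rewrite mul1r ler_norm.
  by rewrite mul0r.
rewrite exchange_big/=.
rewrite (eq_bigr (fun j : 'I_(size s2).+1 =>
   p2 j * pr [set t | tt - lam * j%:R <= lam * (V s1 t)%:R])); last first.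
  move=> j _; rewrite (pr_visits_pred s1 (fun i => tt - lam * j%:R <= lam * i%:R)) mulr_sumr.
  apply: eq_bigr => i _; rewrite natrD mulrDr -lerBlDr [RHS]mulrCA.
  by rewrite (mulrC (p2 j)).
rewrite -natr1 mulrDl mul1r addrA lerD2r.
have p2_sum : \sum_(j < (size s2).+1) p2 j = 1 by exact: visits_total.
(* Given the count [j] of the new block, the induction hypothesis is used at the threshold
   [tt - lam * j]. The resulting factor [expR (lam * j)] averages to at most [M N], and the additive
   error is averaged with total weight 1. *)
apply: (@le_trans _ _ (\sum_(j < (size s2).+1) p2 j *
   (expR (- tt) * \prod_(j < N) M j * expR (lam * j%:R) + N%:R * eps))).
  apply: ler_sum => j _; rewrite ler_wpM2l ?pr_ge0//.
  apply: le_trans (IH _) _; rewrite opprB expRD.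
  by rewrite lerD2r -mulrA mulrC.
under [leLHS]eq_bigr do rewrite mulrDr.
rewrite big_split/= -mulr_suml p2_sum mul1r lerD2r.
rewrite [\prod_(j < N.+1) _]big_ord_recr/= mulrA.
under [leLHS]eq_bigr do rewrite mulrCA.
rewrite -mulr_sumr.
rewrite ler_wpM2l ?Mb// mulr_ge0 ?expR_ge0// prodr_ge0// => j _.
apply: le_trans (Mb j); apply: sumr_ge0 => v _; by rewrite mulr_ge0 ?pr_ge0 ?expR_ge0.
Qed.

End Chernoff.

(** * Deviation of the number of visits before time [n] *)

Section Deviation.
Context {R : realType} {d : measure_display} {T : measurableType d} (P : probability T R).
Context (U : Type) (A : set U) (X : nat -> T -> U).
Hypothesis mX : forall k, measurable (X k @^-1` A).
Context (q n : nat) (p eps : R).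
Hypotheses (q0 : (0 < q)%N) (Xp : forall k, pr P (X k @^-1` A) = p)
  (dec : decoupled P A X q eps) (eps0 : 0 <= eps).

Local Notation pr := (pr P).
Local Notation V := (visits A X).

(* Blocks with the same parity [e] are separated by a gap of [q] indices. *)
Definition block e j := [seq k <- iota ((j * 2 + e) * q) q | (k < n)%N].
Definition blocks e N := flatten (mkseq (block e) N).
(** Number of pairs of blocks that covers the times below [n]; the filter in [block] cuts the
    overshoot. *)
Definition block_count := (n %/ (2 * q)).+1.

Lemma size_block e j : (size (block e j) <= q)%N.
Proof. by rewrite size_filter (leq_trans (count_size _ _))// size_iota. Qed.

Lemma block_gap e N : exists m0 : int, all (fun k => k%:Z <= m0) (blocks e N) /\
  all (fun k => m0 + q%:Z <= k%:Z) (block e N).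
Proof.
exists (((N * 2 + e) * q)%N%:Z - q%:Z); split; last first.
  apply/allP => k; rewrite mem_filter mem_iota => /andP[_ /andP[k1 _]]; lia.
apply/allP => k /flatten_mapP[j]; rewrite mem_iota => /andP[_ jN].
rewrite mem_filter mem_iota => /andP[_ /andP[_ k2]].
have : ((j * 2 + e) * q + q + q <= (N * 2 + e) * q)%N.
  by rewrite -!mulSnr leq_mul2r; apply/orP; right; lia.
lia.
Qed.

Lemma blocks_perm N :
  perm_eq (blocks 0 N ++ blocks 1 N) [seq k <- iota 0 (N * 2 * q) | (k < n)%N].
Proof.
elim: N => [|N IH]; first by [].
rewrite /blocks !mkseqS !flatten_rcons.
have -> : (N.+1 * 2 * q = N * 2 * q + (q + q))%N by lia.
rewrite !iotaD !filter_cat add0n perm_catACA perm_cat//.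
by rewrite /block addn0 mulnDl mul1n.
Qed.

Lemma blocks_iota : perm_eq (blocks 0 block_count ++ blocks 1 block_count) (iota 0 n).
Proof.
apply: perm_trans (blocks_perm _) _; rewrite perm_sym.
have nN : (n <= block_count * 2 * q)%N.
  by rewrite -mulnA /block_count mulSn; have := ltn_ceil n (_ : 0 < 2 * q)%N; lia.
rewrite -(subnKC nN) iotaD filter_cat add0n.
rewrite [X in _ ++ X](_ : _ = [::]) ?cats0; last first.
  apply/eqP; rewrite -(negbK (_ == _)) -has_filter; apply/hasPn => k.
  by rewrite mem_iota => /andP[k1 _]; rewrite -leqNgt.
rewrite [X in perm_eq _ X](_ : _ = iota 0 n)//.
by apply/all_filterP/allP => k; rewrite mem_iota.
Qed.

Lemma visits_blocks t : (V (blocks 0 block_count) t + V (blocks 1 block_count) t)%N = V (iota 0 n) t.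
Proof. by rewrite -visits_cat; apply/seq.permP; exact: blocks_iota. Qed.

Lemma size_blocks : (size (blocks 0 block_count) + size (blocks 1 block_count))%N = n.
Proof. by rewrite -size_cat (perm_size blocks_iota) size_iota. Qed.

Lemma blocks_chernoff e N th tt :
  pr [set t | tt <= th / q%:R * (V (blocks e N) t)%:R]
    <= expR ((expR th - 1) / q%:R * ((size (blocks e N))%:R * p) - tt) + N%:R * eps.
Proof.
have qR : 0 < q%:R :> R by rewrite ltr0n.
have H := @chernoff_blocks R d T P U A X mX q eps (th / q%:R) (block e)
  (fun j => expR ((expR th - 1) / q%:R * ((size (block e j))%:R * p))) N tt dec eps0 (block_gap e).
apply: le_trans (H _) _.
  move=> j; have := @visits_moment R d T P U A X mX (block e j) q%:R th qR.
  rewrite ler_nat size_block => /(_ isT).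
  rewrite (_ : \sum_(k <- block e j) pr (X k @^-1` A) = (size (block e j))%:R * p)//.
  by rewrite (eq_bigr (fun=> p))// big_const_seq count_predT iter_addr_0 mulr_natl.
rewrite lerD2r (addrC _ (- tt)) expRD ler_wpM2l ?expR_ge0//.
rewrite le_eqVlt; apply/orP; left; apply/eqP.
elim: N {H} => [|N IH]; first by rewrite big_ord0 /= mul0r mulr0 expR0.
rewrite big_ord_recr/= IH -expRD -mulrDr -mulrDl -natrD.
by rewrite /blocks mkseqS flatten_rcons size_cat.
Qed.

(** The deviation is a quarter of the total mean [n * p] and not of the mean of this parity, which
    may be small; two parities then add up to [n * p / 2]. *)
Lemma blocks_upper e N : (size (blocks e N) <= n)%N ->
  pr [set t | (size (blocks e N))%:R * p + n%:R * p / 4 <= (V (blocks e N) t)%:R]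
    <= expR (- (n%:R * p / 100 / q%:R)) + N%:R * eps.
Proof.
move=> sn; have qR : 0 < q%:R :> R by rewrite ltr0n.
have p0 : 0 <= p by rewrite -(Xp 0%N) pr_ge0.
set mu := _ * p; pose th : R := 8^-1.
have mun : mu <= n%:R * p by rewrite ler_wpM2r// ler_nat.
have mu0 : 0 <= mu by rewrite mulr_ge0.
(* The exponent becomes at most [(1/7 - 1/8 - 1/32) * n * p], which is below [- n * p / 100]. *)
have eth : expR th <= 8 / 7.
  rewrite -[leRHS]invrK -[leLHS]invrK lef_pV2 ?posrE ?invr_gt0 ?expR_gt0 ?divr_gt0//.
  by rewrite -expRN; apply: le_trans (expR_ge1Dx _); rewrite /th; lra.
have := blocks_chernoff e N th (th / q%:R * (mu + n%:R * p / 4)).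
rewrite (_ : [set t | _] = [set t | mu + n%:R * p / 4 <= (V (blocks e N) t)%:R]); last first.
  by apply/seteqP; split => t /=; rewrite ler_pM2l// divr_gt0 ?invr_gt0.
move=> /le_trans; apply; rewrite lerD2r ler_expR -/mu.
rewrite -[leRHS]mulNr ler_pdivlMr//.
rewrite (_ : _ * q%:R = (expR th - 1) * mu - th * (mu + n%:R * p / 4)); last by field; rewrite gt_eqF.
have := ler_wpM2r mu0 eth; rewrite /th; lra.
Qed.

Lemma blocks_lower e N : (size (blocks e N) <= n)%N ->
  pr [set t | (V (blocks e N) t)%:R <= (size (blocks e N))%:R * p - n%:R * p / 4]
    <= expR (- (n%:R * p / 100 / q%:R)) + N%:R * eps.
Proof.
move=> sn; have qR : 0 < q%:R :> R by rewrite ltr0n.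
have p0 : 0 <= p by rewrite -(Xp 0%N) pr_ge0.
(* A negative [th] turns the same bound into one for the lower tail; here
   [1/8 - 1/9 - 1/32 < - 1/100]. *)
set mu := _ * p; pose th : R := - 8^-1.
have mun : mu <= n%:R * p by rewrite ler_wpM2r// ler_nat.
have mu0 : 0 <= mu by rewrite mulr_ge0.
have eth : expR th <= 8 / 9.
  rewrite /th expRN -[leRHS]invrK lef_pV2 ?posrE ?invr_gt0 ?expR_gt0 ?divr_gt0//.
  by apply: le_trans (expR_ge1Dx _); lra.
have := blocks_chernoff e N th (th / q%:R * (mu - n%:R * p / 4)).
rewrite (_ : [set t | _] = [set t | (V (blocks e N) t)%:R <= mu - n%:R * p / 4]); last first.
  by apply/seteqP; split => t /=; rewrite ler_nM2l// /th mulNr oppr_lt0 divr_gt0 ?invr_gt0.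
move=> /le_trans; apply; rewrite lerD2r ler_expR -/mu.
rewrite -[leRHS]mulNr ler_pdivlMr//.
rewrite (_ : _ * q%:R = (expR th - 1) * mu - th * (mu - n%:R * p / 4)); last by field; rewrite gt_eqF.
have := ler_wpM2r mu0 eth; rewrite /th; lra.
Qed.

Let size_blocks_le e : (e < 2)%N -> (size (blocks e block_count) <= n)%N.
Proof. by have := size_blocks; case: e => [|[|]]//; lia. Qed.

Let count_le : block_count%:R <= n%:R / q%:R + 1 :> R.
Proof.
have qR : 0 < q%:R :> R by rewrite ltr0n.
rewrite /block_count -natr1 lerD2r ler_pdivlMr// -natrM ler_nat.
apply: leq_trans (leq_trunc_div n (2 * q)); rewrite leq_mul2l.
by apply/orP; right; rewrite leq_pmull.
Qed.

Let bound := 4 * expR (- (n%:R * p / 100 / q%:R)) + 4 * ((n%:R / q%:R + 1) * eps).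

Let bound_of (B0 B1 B : set T) : measurable B0 -> measurable B1 -> measurable B ->
  B `<=` B0 `|` B1 ->
  pr B0 <= expR (- (n%:R * p / 100 / q%:R)) + block_count%:R * eps ->
  pr B1 <= expR (- (n%:R * p / 100 / q%:R)) + block_count%:R * eps ->
  pr B <= bound.
Proof.
move=> m0 m1 mB sB b0 b1.
have b2 := pr_le P mB (measurableU _ _ m0 m1) sB.
have b3 := pr_setU_le P m0 m1.
have b4 := ler_wpM2r eps0 count_le.
have := expR_ge0 (- (n%:R * p / 100 / q%:R) : R).
have : 0 <= block_count%:R * eps by rewrite mulr_ge0.
rewrite /bound; lra.
Qed.

(** If the total exceeds its mean by [n * p / 2], one parity exceeds its own mean by [n * p / 4]. *)
Lemma visits_upper :
  pr [set t | 3 / 2 * (n%:R * p) <= (V (iota 0 n) t)%:R] <= bound.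
Proof.
have mQ s (a : R) : measurable [set t | a <= (V s t)%:R].
  exact: (@measurable_visits_pred d T U A X mX s (fun i => a <= i%:R)).
apply: (bound_of (mQ _ _) (mQ _ _) _ _ (blocks_upper (size_blocks_le (isT : 0 < 2)%N))
  (blocks_upper (size_blocks_le (isT : 1 < 2)%N))) => //.
move=> t /=; rewrite -visits_blocks -[in X in X -> _]size_blocks natrD natrD => H.
apply: contrapT => /not_orP[/negP + /negP]; rewrite -!ltNge.
rewrite -[in X in X -> _ -> _]size_blocks -[in X in _ -> X -> _]size_blocks !natrD; lra.
Qed.

Lemma visits_lower :
  pr [set t | (V (iota 0 n) t)%:R <= 2^-1 * (n%:R * p)] <= bound.
Proof.
have mQ s (a : R) : measurable [set t | (V s t)%:R <= a].
  exact: (@measurable_visits_pred d T U A X mX s (fun i => i%:R <= a)).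
apply: (bound_of (mQ _ _) (mQ _ _) _ _ (blocks_lower (size_blocks_le (isT : 0 < 2)%N))
  (blocks_lower (size_blocks_le (isT : 1 < 2)%N))) => //.
move=> t /=; rewrite -visits_blocks -[in X in X -> _]size_blocks natrD natrD => H.
apply: contrapT => /not_orP[/negP + /negP]; rewrite -!ltNge.
rewrite -[in X in X -> _ -> _]size_blocks -[in X in _ -> X -> _]size_blocks !natrD; lra.
Qed.

End Deviation.

(** * From [beta]-mixing of the two-sided extension to decoupled counts *)

Section Decoupling.
Context {R : realType} {d : nat}.
Context {disp disp' : measure_display} {T : measurableType disp} {T' : measurableType disp'}
  (P : probability T R) (P' : probability T' R)
  (X : nat -> T -> 'rV[R]_d) (Z : int -> T' -> 'rV[R]_d).
Hypothesis Z_ext : stationary_extension P X P' Z.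

(** [measurable_visits] is applied with the generated sigma-algebra itself as the measurable
    structure. *)
Lemma generated_visits (I : Type) (S : pointedType) (W : I -> S -> 'rV[R]_d) (D : set I) (A : set 'rV[R]_d)
    (g : nat -> I) (s : seq nat) (i : nat) :
  borel_rV A -> (forall k, k \in s -> D (g k)) ->
  generated_by W D [set z | visits A (fun k => W (g k)) s z = i].
Proof.
move=> mA sD.
apply: (@measurable_visits _ (g_sigma_algebraType
  [set B | exists i B', [/\ D i, borel_rV B' & B = W i @^-1` B']])) => k ks.
by apply: sub_sigma_algebra; exists (g k), A; split => //; exact: sD.
Qed.

(** The mixing coefficients separate time at 0, so a past ending at [m0] is moved there. The shift
    takes place in the extension, whose index set is a group. *)
Lemma shifted_law (m0 : int) C : @product_salgebra R d nat C ->
  P [set t | C (fun k => X k t)] = P' [set t | C (fun k : nat => Z (k%:Z - m0) t)].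
Proof.
move=> mC; case: Z_ext => -[_ /(_ (- m0)) ZZ] ZX.
rewrite -(ZX _ mC).
pose C' : set (int -> 'rV[R]_d) := [set z | C (fun k : nat => z k%:Z)].
have mC' : product_salgebra C'.
  have := @generated_preimage _ _ (fun (z : int -> 'rV[R]_d) (k : nat) => z k%:Z) _
    (@product_salgebra R d int) (smallest_sigma_algebra _ _) _ C mC; apply.
  move=> _ [k [B [mB ->]]]; apply: sub_sigma_algebra.
  by exists k%:Z, B.
by have := ZZ _ mC'.
Qed.

(** The level sets of the two shifted counts are partitions admissible in the supremum; the 2
    compensates the [2^-1] in front of it. *)
Lemma mixing_decoupled (A : set 'rV[R]_d) q B : borel_rV A ->
  (forall k, measurable (X k @^-1` A)) ->
  (beta_mixing P' Z q <= B%:E)%E -> decoupled P A X q (2 * B).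
Proof.
move=> mA mX; rewrite /beta_mixing lee_pdivrMl// => HB m0 s1 s2 g1 g2.
pose W (k : nat) (t : T') := Z (k%:Z - m0) t.
pose G1 := generated_by Z [set k : int | k <= 0].
pose G2 := generated_by Z [set k : int | q%:Z <= k].
have mU i : G1 [set t | visits A W s1 t = i].
  apply: generated_visits => // k ks /=.
  by rewrite subr_le0; exact: (allP g1).
have mV i : G2 [set t | visits A W s2 t = i].
  apply: generated_visits => // k ks /=.
  by rewrite lerBrDl; exact: (allP g2).
have mN (s : seq nat) i : product_salgebra
    [set z : nat -> 'rV[R]_d | visits A (fun k z => z k) s z = i].
  have : generated_by (fun k (z : nat -> 'rV[R]_d) => z k) setT
      [set z : nat -> 'rV[R]_d | visits A (fun k z => z k) s z = i].
    exact: generated_visits.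
  by apply: sub_sigma_algebra2 => C [k [D [_ mD ->]]]; exists k, D.
have mNI (i j : nat) : product_salgebra
    ([set z : nat -> 'rV[R]_d | visits A (fun k z => z k) s1 z = i] `&`
     [set z | visits A (fun k z => z k) s2 z = j]).
  exact: (@measurableI _ (g_sigma_algebraType
    [set C : set (nat -> 'rV[R]_d) | exists i B, borel_rV B /\ C = [set z | B (z i)] ])
    _ _ (mN s1 i) (mN s2 j)).
have law s i : P [set t | visits A X s t = i] = P' [set t | visits A W s t = i].
  exact: (shifted_law m0 (mN s i)).
have lawI i j : P ([set t | visits A X s1 t = i] `&` [set t | visits A X s2 t = j]) =
    P' ([set t | visits A W s1 t = i] `&` [set t | visits A W s2 t = j]).
  exact: (shifted_law m0 (mNI i j)).
have mX' s i : measurable [set t | visits A X s t = i] by exact: measurable_visits.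
have part (s : seq nat) (G : set (set T')) : (forall i, G [set t | visits A W s t = i]) ->
    finite_partition G (fun i : 'I_(size s).+1 => [set t | visits A W s t = i]).
  move=> mG; split=> //; first by move=> i j _ _ [t [/= Hi Hj]]; apply: val_inj; rewrite /= -Hi -Hj.
  apply/seteqP; split=> // t _.
  by exists (Ordinal (visits_le A W s t)).
rewrite -lee_fin; apply: le_trans HB.
apply: ereal_sup_ubound.
exists (size s1).+1, (size s2).+1.
exists (fun i => [set t | visits A W s1 t = i]), (fun j => [set t | visits A W s2 t = j]).
split; [exact: part|exact: part|].
rewrite -sumEFin; apply: eq_bigr => i _; rewrite -sumEFin; apply: eq_bigr => j _.
by rewrite -lawI -!law !prE//; apply: measurableI.
Qed.

End Decoupling.

(** * Bandwidths *)

Section Bandwidth.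
Context {R : realType}.
Implicit Types b h y : R.

(** Frees the definition from quotients: for [v = 0] the left side compares [+oo] with [w] and the
    right side reads [y <= 0], so both fail. *)
Lemma sqrt_quotient_le y v w : 0 < y -> 0 <= v -> 0 < w ->
  ((y%:E / v%:E) `^ 2^-1 <= w%:E)%E = (y <= v * w ^+ 2) :> bool.
Proof.
move=> y0 v0 w0; rewrite inver; case: eqVneq => [->|vN0].
  by rewrite gt0_muley ?lte_fin// poweRyr ?invr_eq0 ?pnatr_eq0// leye_eq mul0r [RHS]leNgt y0.
have {}v0 : 0 < v by rewrite lt_neqAle eq_sym vN0.
rewrite -EFinM poweR_EFin lee_fin powR12_sqrt ?divr_ge0 ?(ltW y0) ?(ltW v0)//.
by rewrite -[in LHS](gtr0_norm w0) -sqrtr_sqr ler_sqrt ?exprn_ge0 ?(ltW w0)// ler_pdivrMr// mulrC.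
Qed.

Lemma psi_ge1 b h0 h : 0 < b -> 0 < h <= h0 -> 1 <= psi b h0 h.
Proof.
move=> b0 /andP[hp hh]; rewrite /psi lerDl mulr_ge0 ?(ltW b0)// ln_ge0//.
by rewrite ler_pdivlMr// mul1r.
Qed.

Lemma psi_antitone b h0 h h' : 0 < b -> 0 < h -> h <= h' -> h' <= h0 ->
  psi b h0 h' <= psi b h0 h.
Proof.
move=> b0 hp hh hh0; have h'p := lt_le_trans hp hh; have h0p := lt_le_trans h'p hh0.
rewrite /psi lerD2l ler_wpM2l ?(ltW b0)// ler_ln ?posrE ?divr_gt0//.
by rewrite ler_wpM2l ?(ltW h0p)// lef_pV2.
Qed.

Lemma psi_continuous b h0 h : 0 < h0 -> 0 < h -> {for h, continuous (psi b h0)}.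
Proof.
move=> h00 hp; rewrite /psi.
have c1 : {for h, continuous (fun h => ln (h0 / h))}.
  apply: (@continuous_comp _ _ _ (fun h => h0 / h) (@ln R)).
    by apply: cvgMr; apply: cvgV; [rewrite gt_eqF|exact: cvg_id].
  by apply: continuous_ln; rewrite divr_gt0.
by apply: cvgD; [exact: cvg_cst|apply: cvgMr].
Qed.

Lemma bandwidth_ext b h0 w V V' : (forall h, 0 < h <= h0 -> V h = V' h) ->
  bandwidth b h0 w V = bandwidth b h0 w V' :> R.
Proof.
move=> VV; congr set_min; apply/seteqP.
by split => h [hh]; rewrite ?VV// => H; split => //; rewrite ?VV.
Qed.

(** [psi] decreases and [v * w ^+ 2] increases, so the set is closed upwards. It contains [h0]
    because [psi] equals 1 there, stays away from 0 because [psi] blows up, and contains its infimum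
    by right continuity, all that a count of visits offers. *)
Lemma bandwidthP b h0 (w v : R -> R) : 0 < b -> 0 < h0 ->
  (forall h, 0 < h <= h0 -> 0 < w h) ->
  (forall h, 0 < h -> {for h, continuous w}) ->
  (forall h h', 0 < h -> h <= h' -> h' <= h0 -> w h <= w h') ->
  (forall h, 0 < h <= h0 -> 0 <= v h) ->
  (forall h h', 0 < h -> h <= h' -> h' <= h0 -> v h <= v h') ->
  (forall h, 0 < h < h0 -> v h' @[h' --> h^'+] --> v h) ->
  1 <= v h0 * w h0 ^+ 2 ->
  let m := bandwidth b h0 w (fun h => (v h)%:E) in
  0 < m <= h0 /\ forall h, 0 < h <= h0 -> (m <= h) = (psi b h0 h <= v h * w h ^+ 2).
Proof.
move=> b0 h00 w0 wc wi v0 vi vc vw m.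
have h0h0 : 0 < h0 <= h0 by rewrite h00 lexx.
pose S := [set h | 0 < h <= h0 /\ psi b h0 h <= v h * w h ^+ 2].
have SE : [set h | 0 < h <= h0 /\ (((psi b h0 h)%:E / (v h)%:E) `^ 2^-1 <= (w h)%:E)%E] = S.
  apply/seteqP; split => h [hh]; have p1 := psi_ge1 b0 hh.
    by rewrite sqrt_quotient_le ?v0 ?w0// (lt_le_trans _ p1).
  by rewrite -sqrt_quotient_le ?v0 ?w0// (lt_le_trans _ p1).
have vw_le h h' : 0 < h -> h <= h' -> h' <= h0 -> v h * w h ^+ 2 <= v h' * w h' ^+ 2.
  move=> hp hh h'h0; have h'p := lt_le_trans hp hh.
  have wh : 0 < w h by rewrite w0// hp (le_trans hh).
  have wh' : 0 < w h' by rewrite w0// h'p.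
  apply: ler_pM; rewrite ?exprn_ge0 ?(ltW wh)//; last 2 first.
  - exact: vi.
  - by rewrite ler_pXn2r ?nnegrE ?(ltW wh) ?(ltW wh')// wi.
  by rewrite v0// hp (le_trans hh).
have Sup h h' : S h -> h <= h' -> h' <= h0 -> S h'.
  move=> [/andP[hp hh0] Sh] hh h'h0; have h'p := lt_le_trans hp hh.
  split; first by rewrite h'p.
  apply: le_trans (psi_antitone b0 hp hh h'h0) _; apply: le_trans Sh _.
  exact: vw_le.
have Sh0 : S h0 by split => //; rewrite /psi divff ?gt_eqF// ln1 mulr0 addr0.
(* Membership of [h] forces [b * ln (h0 / h) <= v h0 * w h0 ^+ 2], hence a positive lower bound on
   [h]. *)
pose K := v h0 * w h0 ^+ 2 / b.
have Slow h : S h -> h0 * expR (- K) <= h.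
  move=> [/andP[hp hh0] Sh].
  have : psi b h0 h <= v h0 * w h0 ^+ 2.
    by apply: le_trans Sh _; exact: vw_le.
  rewrite /psi => H; have lK : ln (h0 / h) <= K.
    by rewrite /K ler_pdivlMr// mulrC; lra.
  rewrite expRN ler_pdivrMr ?expR_gt0// mulrC -ler_pdivrMr//.
  by rewrite -[leLHS](@lnK R) ?posrE ?divr_gt0// ler_expR.
have hS : has_inf S by split; [exists h0|exists (h0 * expR (- K)) => h /Slow].
pose i := inf S.
have ip : 0 < i.
  apply: (@lt_le_trans _ _ (h0 * expR (- K))); first by rewrite mulr_gt0// expR_gt0.
  by apply: lb_le_inf; [exists h0|move=> h /Slow].
have ilb : lbound S i by apply: ge_inf; case: hS.
have ih0 : i <= h0 by exact: ilb.
have Si : S i.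
  move: ih0; rewrite le_eqVlt => /orP[/eqP->//|ih0].
  split; first by rewrite ip ltW.
  have c1 : psi b h0 x @[x --> i^'+] --> psi b h0 i.
    exact/cvg_at_right_filter/psi_continuous.
  have c2 : (v x * w x ^+ 2) @[x --> i^'+] --> v i * w i ^+ 2.
    have cw : w x @[x --> i^'+] --> w i by exact/cvg_at_right_filter/wc.
    apply: cvgM; first by apply: vc; rewrite ip.
    by rewrite expr2; under eq_fun do rewrite expr2; apply: cvgM.
  apply: (ler_cvg_to c1 c2); near=> x.
  have ix : i < x by near: x; exact: nbhs_right_gt.
  have xh0 : x <= h0 by near: x; exact: nbhs_right_le.
  have [y Sy yx] := inf_lt (proj1 hS) ix.
  by have [] := Sup y x Sy (ltW yx) xh0.
have -> : m = i.
  rewrite /m /bandwidth /set_min SE.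
  have : [set h | S h /\ lbound S h] (xget 0 [set h | S h /\ lbound S h]) by apply: xgetI; split; [exact: Si|exact: ilb].
  by move=> [S1 S2]; apply/eqP; rewrite eq_le S2//= ilb.
split; first by rewrite ip.
move=> h hh; apply/idP/idP => [ih|Sh].
  by case/andP: hh => _ hh0; have [] := Sup i h Si ih hh0.
by apply: ilb; split.
Unshelve. all: by end_near. Qed.

End Bandwidth.

(** * The random bandwidth and its measurability *)

Section RandomBandwidth.
Context {R : realType} {d : nat} {disp : measure_display} {T : measurableType disp}.
Context (X : nat -> T -> 'rV[R]_d) (x : 'rV[R]_d) (sigma b h0 : R) (w : R -> R) (n : nat).
Hypotheses (mX : forall k h, measurable (X k @^-1` eball x h))
  (sigma0 : 0 < sigma) (b0 : 0 < b) (h00 : 0 < h0)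
  (w0 : forall h, 0 < h <= h0 -> 0 < w h)
  (wc : forall h, 0 < h -> {for h, continuous w})
  (wi : forall h h', 0 < h -> h <= h' -> h' <= h0 -> w h <= w h').

Let L := Lcount X x sigma n.
Let Om := Omega0 L w h0.
Let Hw := random_bandwidth b h0 w L.

Lemma LcountE h t : L h t = sigma ^- 2 * (visits (eball x h) X (iota 0 n) t)%:R.
Proof.
rewrite /L /Lcount big_add1/=; congr (_ * _).
by rewrite (visitsE _ _) /index_iota subn0.
Qed.

Lemma Lcount_ge0 h t : 0 <= L h t.
Proof. by rewrite LcountE mulr_ge0// invr_ge0 exprn_ge0// ltW. Qed.

Lemma Lcount_homo h h' t : h <= h' -> L h t <= L h' t.
Proof.
move=> hh; rewrite !LcountE ler_wpM2l ?invr_ge0 ?exprn_ge0 ?(ltW sigma0)// ler_nat.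
by apply: sub_count => k; rewrite !inE/= => /le_trans; apply.
Qed.

(** The balls are closed: each of the finitely many points outside the ball stays outside for
    slightly larger radii, so the count is locally constant on the right. *)
Lemma Lcount_right_continuous h t : L h' t @[h' --> h^'+] --> L h t.
Proof.
have H (s : seq nat) : \forall h' \near h^'+,
    visits (eball x h') X s t = visits (eball x h) X s t.
  elim: s => [|k s IH]; first by apply: nearW.
  have Hk : \forall h' \near h^'+, (X k t \in eball x h') = (X k t \in eball x h).
    have [ball|nball] := leP (enorm (X k t - x)) h.
      apply: filterS (nbhs_right_gt h) => h' hh'.
      by rewrite !mem_set//= /eball/= (le_trans ball)// ltW.
    apply: filterS (nbhs_right_lt nball) => h' hh'.
    by rewrite !memNset// /eball/=; apply/negP; rewrite -ltNge.
  near=> h'; rewrite /visits/=; congr (_ + _)%N; first by congr nat_of_bool; near: h'.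
  by near: h'.
apply: (@cvg_trans _ (L h t @[_ --> h^'+])); last exact: cvg_cst.
apply: near_eq_cvg; near=> h'.
rewrite !LcountE; congr (_ * _%:R); near: h'.
by have := H (iota 0 n); apply: filterS => h' ->.
Unshelve. all: by end_near. Qed.

(** As [psi] equals 1 at [h0], this is the event that [h0] itself is an admissible bandwidth. *)
Lemma Omega0E : Om = [set t | 1 <= L h0 t * w h0 ^+ 2].
Proof.
have h0h0 : 0 < h0 <= h0 by rewrite h00 lexx.
apply/seteqP; split => t; rewrite /Om /Omega0 /=.
  by rewrite -[X in (X `^ _)%E]mul1e sqrt_quotient_le ?Lcount_ge0 ?w0.
by rewrite -[X in _ -> is_true (X `^ _ <= _)%E]mul1e sqrt_quotient_le ?Lcount_ge0 ?w0.
Qed.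

Lemma random_bandwidthP t : Om t -> 0 < Hw t <= h0 /\
  forall h, 0 < h <= h0 -> (Hw t <= h) = (psi b h0 h <= L h t * w h ^+ 2).
Proof.
rewrite Omega0E => /= Omt.
apply: (@bandwidthP R b h0 w (L ^~ t)) => //.
- by move=> h _; exact: Lcount_ge0.
- by move=> h h' _ hh _; exact: Lcount_homo.
- by move=> h _; exact: Lcount_right_continuous.
Qed.

Lemma measurable_Lcount_event h (Q : R -> bool) : measurable [set t | Q (L h t)].
Proof.
have := @measurable_visits_pred _ T _ (eball x h) X (fun k => mX k h) (iota 0 n)
  (fun i => Q (sigma ^- 2 * i%:R)).
by congr measurable; apply/seteqP; split => t /=; rewrite LcountE.
Qed.

Lemma measurable_Omega0 : measurable Om.
Proof. by rewrite Omega0E; exact: (measurable_Lcount_event h0 (fun l => 1 <= l * w h0 ^+ 2)). Qed.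

(** On [Om], comparing [Hw] with [h] is a condition on the single count [L h]. *)
Lemma measurable_random_bandwidth : measurable_fun Om Hw.
Proof.
move=> mOm; apply: (measurability _ (RGenOInfty.measurableE R)) => //.
move=> _ [_ [h ->] <-].
have [hp|hp] := leP h 0.
  rewrite (_ : _ `&` _ = Om)//; apply/seteqP; split=> [t []//|t Omt]; split=> //=.
  by have [/andP[H _] _] := random_bandwidthP Omt; rewrite in_itv/= andbT (le_lt_trans hp).
have [hh|hh] := leP h h0; last first.
  rewrite (_ : _ `&` _ = set0)//; apply/seteqP; split=> // t [Omt /=].
  by have [/andP[_ H] _] := random_bandwidthP Omt; rewrite in_itv/= andbT ltNge (le_trans H)// ltW.
rewrite (_ : _ `&` _ = Om `&` [set t | ~~ (psi b h0 h <= L h t * w h ^+ 2)]).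
  apply: measurableI => //.
  exact: (measurable_Lcount_event h (fun l => ~~ (psi b h0 h <= l * w h ^+ 2))).
apply/seteqP; split=> t [Omt /=]; have [_ H] := random_bandwidthP Omt.
  by rewrite in_itv/= andbT => Hh; split=> //; rewrite -H ?hp// -ltNge.
by rewrite -H ?hp// -ltNge => Hh; split=> //=; rewrite in_itv/= andbT.
Qed.

Lemma measurable_random_bandwidth_event c c' :
  measurable ([set t | c <= w (Hw t) <= c'] `&` Om).
Proof.
have mw : measurable_fun (`]0%R, +oo[ : set R) w.
  apply: subspace_continuous_measurable_fun; first exact: measurable_itv.
  rewrite (continuous_open_subspace _ (rray_open (0 : R))).
  by move=> h; rewrite inE/= in_itv/= andbT; exact: wc.
have mB := mw (measurable_itv _) (`[c, c']%classic : set R) (measurable_itv _).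
have mH := measurable_random_bandwidth measurable_Omega0 mB.
(* [w] is known to be measurable only on []0, +oo[], where [Hw] takes its values on [Om]. *)
rewrite setIC (_ : _ `&` _ = Om `&` Hw @^-1` (`]0, +oo[ `&` w @^-1` `[c, c']))//.
apply/seteqP; split=> t [Omt]; have [/andP[H _] _] := random_bandwidthP Omt;
  rewrite /= !in_itv/= ?andbT => Hc; split=> //; last by case: Hc.
Qed.

End RandomBandwidth.

(** * The stationary sequence *)

Section Instance.
Context {R : realType} (m : mixing_type) (eta kappa tau s sigma : R) (lX lw : R -> R).
Implicit Types h u e c : R.
Hypotheses (eta0 : 0 < eta) (kappa0 : 0 < kappa) (tau_ge : -1 <= tau) (s0 : 0 < s)
  (sigma0 : 0 < sigma) (lX_sv : slowly_varying lX) (lw_sv : slowly_varying lw).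

Let w := rate s lw.
Definition ball_mass h := h `^ (tau + 1) * lX h.
Local Notation p := ball_mass.

Lemma rate_rv : regularly_varying s w.
Proof.
rewrite -[s]addr0; apply: regularly_varyingM; first exact: regularly_varying_powR.
exact/slowly_varyingE.
Qed.

Lemma ball_mass_rv : regularly_varying (tau + 1) p.
Proof.
rewrite -[tau + 1]addr0; apply: regularly_varyingM; first exact: regularly_varying_powR.
exact/slowly_varyingE.
Qed.

(** Stated through [tau], [s], [lX], [lw] alone, so that a rate built on [hs] cannot depend on the
    process or on its [h0]. *)
Definition monotone_window (hs : R) : Prop := [/\ 0 < hs,
  forall h h', 0 < h -> h <= h' -> h' <= hs -> p h <= p h',
  forall h h', 0 < h -> h <= h' -> h' <= hs -> w h <= w h' &
  forall h, 0 < h <= hs -> p h <= 1].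

Context (hs : R).
Hypothesis window : monotone_window hs.

Let a := (tau + 1) / (2 * s + (tau + 1)).
Let E := envelope p w hs.
Definition slow_rate := slow_factor m kappa a E.

Let w_gt0 h : 0 < h -> 0 < w h.
Proof. by have [H _ _] := rate_rv; exact: H. Qed.

Let p_gt0 h : 0 < h -> 0 < p h.
Proof. by have [H _ _] := ball_mass_rv; exact: H. Qed.

Let rho0 : 0 < 2 * s + (tau + 1).
Proof. by have := tau_ge; have := s0; lra. Qed.

Let a1 : a < 1.
Proof. by rewrite ltr_pdivrMr// mul1r ltrDr mulr_gt0. Qed.

Let E_rv : regularly_varying a E.
Proof.
have [hs0 pi wi p1] := window; have [_ _ pl] := ball_mass_rv; have [_ _ wl] := rate_rv.
apply: envelope_regularly_varying => //; first by have := tau_ge; lra.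
- by move=> h /andP[/p_gt0].
- by move=> h /andP[/w_gt0].
Qed.

Let E_le1 u : E u <= 1.
Proof. by have [hs0 pi wi p1] := window; apply: envelope_le1. Qed.

Let E_scale y u : 1 <= y -> 0 < u -> E (y * u) <= y * E u.
Proof.
have [hs0 pi wi p1] := window; apply: envelope_scale => //.
- by move=> h /andP[/p_gt0].
Qed.

Lemma slow_rate_slow : slowly_varying slow_rate.
Proof. by apply: slow_factor_slow => //. Qed.

Lemma rate_exponentE : rate_exponent m kappa a = delta m kappa tau s.
Proof.
rewrite /rate_exponent /delta /a; have := rho0; have := kappa0; have := s0.
case: m => s0' k0' r0'; field; rewrite !gt_eqF//=; lra.
Qed.

Let phi := deviation m (delta m kappa tau s) 1 slow_rate.

Let block_small c e : 0 < c -> 0 < e -> \forall n \near \oo,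
  4 * expR (- (c * (E n%:R^-1 / n%:R^-1) / (block_length m kappa E n)%:R))
    + 4 * ((n%:R / (block_length m kappa E n)%:R + 1)
           * (2 / Psi_inv m eta kappa (2 * block_length m kappa E n)%:R)) <= e * phi n.
Proof.
rewrite /phi -rate_exponentE => c0 e0; case mE: m.
- by rewrite -mE; apply: (block_error_small_geometric (a := a)).
- by rewrite -mE; apply: (block_error_small_arithmetic (a := a)).
Qed.

Context (d : nat) (disp disp' : measure_display) (T : measurableType disp)
  (T' : measurableType disp') (P : probability T R) (P' : probability T' R)
  (X : nat -> T -> 'rV[R]_d) (Z : int -> T' -> 'rV[R]_d) (x : 'rV[R]_d) (h0 b : R).
Hypotheses (h00 : 0 < h0) (b0 : 0 < b) (X_stat : strictly_stationary P X)
  (w_incr : {in `[0, h0] &, {homo w : h h' / h <= h'}})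
  (PX_local : forall h, 0 < h <= h0 -> P (X 0%N @^-1` eball x h) = (p h)%:E)
  (Z_ext : stationary_extension P X P' Z)
  (Z_mixing : mixing P' Z m eta kappa).

Let L := Lcount X x sigma.
Let Om n := Omega0 (L n) w h0.
Let Hw n := random_bandwidth b h0 w (L n).
Let hw n := mean_bandwidth P b h0 w (L n).
Let q n := block_length m kappa E n.
Let v n h := sigma ^- 2 * (n%:R * p h).

Let wc h : 0 < h -> {for h, continuous w}.
Proof. by have [_ H _] := rate_rv; exact: H. Qed.

Let pc h : 0 < h -> {for h, continuous p}.
Proof. by have [_ H _] := ball_mass_rv; exact: H. Qed.

Let wi h h' : 0 < h -> h <= h' -> h' <= h0 -> w h <= w h'.
Proof.
move=> hp hh hh0; apply: w_incr => //; rewrite in_itv/=; apply/andP; split; lra.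
Qed.

Let mX k h : measurable (X k @^-1` eball x h).
Proof. by have [H _] := X_stat; apply: H; exact: eball_borel. Qed.

Let Xp k h : 0 < h <= h0 -> pr P (X k @^-1` eball x h) = p h.
Proof.
move=> hh; have [_ /(_ k) H] := X_stat.
pose C : set (nat -> 'rV[R]_d) := [set z | eball x h (z 0%N)].
have mC : product_salgebra C.
  by apply: sub_sigma_algebra; exists 0%N, (eball x h); split => //; exact: eball_borel.
have := H C mC; rewrite /C/= add0r => HC.
by rewrite /pr (_ : P _ = P (X 0%N @^-1` eball x h))// PX_local.
Qed.

Let pi h h' : 0 < h -> h <= h' -> h' <= h0 -> p h <= p h'.
Proof.
move=> hp hh hh0; have h'p := lt_le_trans hp hh.
rewrite -(@Xp 0%N h) ?hp ?(le_trans hh)// -(@Xp 0%N h') ?h'p//.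
by apply: pr_le => // t; rewrite /preimage/= /eball/= => /le_trans; apply.
Qed.

Lemma ball_mass_le1 h : 0 < h <= h0 -> p h <= 1.
Proof. by move=> hh; rewrite -(@Xp 0%N h)// pr_le1. Qed.

Lemma stationary_monotone_window : monotone_window h0.
Proof. by split; [exact: h00|exact: pi|exact: wi|exact: ball_mass_le1]. Qed.

Let expectation_Lcount n h : 0 < h <= h0 -> ('E_P[L n h] = (v n h)%:E)%E.
Proof.
move=> hh; rewrite unlock.
transitivity (\int[P]_t (\sum_(k <- iota 0 n) sigma ^- 2 * \1_(X k @^-1` eball x h) t)%:E)%E.
  apply: eq_integral => t _; congr EFin.
  by rewrite /L LcountE visitsE mulr_sumr.
rewrite integral_sum_indic//; last by move=> _; rewrite invr_ge0 exprn_ge0// ltW.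
congr EFin; rewrite -mulr_sumr; congr (_ * _).
rewrite (eq_bigr (fun=> p h)); last by move=> k _; rewrite Xp.
by rewrite big_const_seq count_predT iter_addr_0 size_iota mulr_natl.
Qed.

Let v_large h : 0 < h <= h0 -> forall K, \forall n \near \oo, K <= v n h * w h ^+ 2.
Proof.
move=> /andP[hp hh] K.
have c0 : 0 < sigma ^- 2 * p h * w h ^+ 2.
  apply: mulr_gt0; last by rewrite exprn_gt0// w_gt0.
  by apply: mulr_gt0; [rewrite invr_gt0 exprn_gt0|exact: p_gt0].
near=> n; have : K / (sigma ^- 2 * p h * w h ^+ 2) <= n%:R by near: n; exact: nbhs_infty_ger.
by rewrite ler_pdivrMr// /v => /le_trans; apply; rewrite le_eqVlt; apply/orP; left; apply/eqP; ring.
Unshelve. all: by end_near. Qed.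

Let mean_bandwidthP n : 1 <= v n h0 * w h0 ^+ 2 -> 0 < hw n <= h0 /\
  forall h, 0 < h <= h0 -> (hw n <= h) = (psi b h0 h <= v n h * w h ^+ 2).
Proof.
move=> Hn; rewrite /hw /mean_bandwidth (@bandwidth_ext R b h0 w _ (fun h => (v n h)%:E)); last exact: expectation_Lcount.
have s20 : 0 <= sigma ^- 2 by rewrite invr_ge0 exprn_ge0// ltW.
apply: bandwidthP => //.
- by move=> h /andP[/w_gt0].
- by move=> h /andP[/p_gt0 ? _]; rewrite /v mulr_ge0// mulr_ge0// ltW.
- by move=> h h' hp hh hh0; rewrite /v ler_wpM2l// ler_wpM2l// pi.
- move=> h /andP[hp _]; apply: cvg_at_right_filter.
  by apply: cvgMr; apply: cvgMr; exact: pc.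
Qed.

Let mean_bandwidth_near : \forall n \near \oo, 0 < hw n <= h0 /\
  forall h, 0 < h <= h0 -> (hw n <= h) = (psi b h0 h <= v n h * w h ^+ 2).
Proof.
have h0h0 : 0 < h0 <= h0 by rewrite h00 lexx.
by apply: filterS (v_large h0h0 1) => n; exact: mean_bandwidthP.
Qed.

(** [hw n] tends to 0: at a fixed [h], [v n h * w h ^+ 2] grows linearly in [n] and passes the fixed
    value [psi b h0 h]. *)
Let mean_bandwidth_small (Q : R -> Prop) :
  (\forall h \near (0:R)^'+, Q h) -> \forall n \near \oo, Q (hw n).
Proof.
move=> /near0P[e e0 H]; pose h := Num.min e h0.
have hh : 0 < h <= h0 by rewrite lt_min e0 h00 ge_min lexx orbT.
near=> n.
have [/andP[hwp _] iff] : 0 < hw n <= h0 /\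
  forall h, 0 < h <= h0 -> (hw n <= h) = (psi b h0 h <= v n h * w h ^+ 2) by near: n; exact: mean_bandwidth_near.
apply: H; rewrite hwp/=; apply: (@le_trans _ _ h); last by rewrite ge_min lexx.
rewrite iff//; near: n; exact: v_large.
Unshelve. all: by end_near. Qed.

(* Only [1 <= psi] is used, so that the rate does not depend on [b] and [h0]. *)
Let envelope_le_mass n : (0 < n)%N -> 0 < hw n <= h0 -> hw n <= hs ->
  psi b h0 (hw n) <= v n (hw n) * w (hw n) ^+ 2 ->
  E n%:R^-1 <= Num.max 1 (sigma ^- 2) * p (hw n).
Proof.
move=> n0 hh hws H; have [hs0 pis wis p1s] := window.
have /andP[hwp hwh0] := hh.
have ph := p_gt0 hwp; have wh := w_gt0 hwp.
have nR : 0 < n%:R :> R by rewrite ltr0n.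
apply: envelope_le => // h /andP[hp hhs].
have [hhw|/ltW hhw] := leP h (hw n); rewrite ge_min; apply/orP; [left|right].
  apply: le_trans (pis _ _ hp hhw hws) _; rewrite -[leLHS]mul1r ler_wpM2r ?(ltW ph)//.
  by rewrite le_max lexx.
have wwh : w (hw n) <= w h by exact: wis.
have : 1 <= v n (hw n) * w (hw n) ^+ 2 by apply: le_trans H; exact: psi_ge1.
rewrite /v => H1.
apply: (@le_trans _ _ (sigma ^- 2 * p (hw n))); last by rewrite ler_wpM2r ?(ltW ph)// le_max lexx orbT.
rewrite ler_pdivrMr ?exprn_gt0 ?w_gt0// -(ler_pM2l nR) mulfV ?gt_eqF//.
apply: le_trans H1 _.
have -> : n%:R * (sigma ^- 2 * p (hw n) * w h ^+ 2) = sigma ^- 2 * (n%:R * p (hw n)) * w h ^+ 2 by ring.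
apply: ler_wpM2l.
  apply: mulr_ge0; first by rewrite invr_ge0 exprn_ge0// ltW.
  by apply: mulr_ge0; [exact: ltW|exact: ltW].
by rewrite ler_pXn2r ?nnegrE ?(ltW wh) ?(ltW (w_gt0 hp)).
Qed.

Let mixing_block n h : decoupled P (eball x h) X (q n) (2 / Psi_inv m eta kappa (2 * q n)%:R).
Proof.
apply: (mixing_decoupled Z_ext); first exact: eball_borel.
- by move=> k; exact: mX.
- exact: Z_mixing.
Qed.

Let Psi_inv_ge0 n : 0 <= 2 / Psi_inv m eta kappa (2 * q n)%:R.
Proof.
rewrite divr_ge0//; case: m; first by rewrite Psi_inv_geometric// expR_ge0.
by rewrite Psi_inv_arithmetic ?ltr0n// powR_ge0.
Qed.

(** The radius is quantified after [n], since it will be taken to depend on [n]; only the lower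
    bound on its mass matters. *)
Let deviation_small c e : 0 < c -> 0 < e -> \forall n \near \oo,
  forall h, 0 < h <= h0 -> c * E n%:R^-1 <= p h ->
    pr P [set t | 3 / 2 * v n h <= L n h t] <= e * phi n /\
    pr P [set t | L n h t <= 2^-1 * v n h] <= e * phi n.
Proof.
move=> c0 e0; have c100 : 0 < c / 100 by rewrite divr_gt0.
have s20 : 0 < sigma ^- 2 by rewrite invr_gt0 exprn_gt0.
apply: filterS (block_small c100 e0) => n Hn h hh cp.
have Hu := @visits_upper R disp T P _ (eball x h) X (fun k => mX k h) (q n) n (p h) _
  (ltn0Sn _) (fun k => Xp k hh) (@mixing_block n h) (@Psi_inv_ge0 n).
have Hl := @visits_lower R disp T P _ (eball x h) X (fun k => mX k h) (q n) n (p h) _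
  (ltn0Sn _) (fun k => Xp k hh) (@mixing_block n h) (@Psi_inv_ge0 n).
have qR : 0 < (q n)%:R :> R by rewrite ltr0n.
have Hb : 4 * expR (- (n%:R * p h / 100 / (q n)%:R)) +
    4 * ((n%:R / (q n)%:R + 1) * (2 / Psi_inv m eta kappa (2 * q n)%:R)) <= e * phi n.
  apply: le_trans Hn; rewrite lerD2r ler_wpM2l// ler_expR lerN2.
  rewrite ler_wpM2r ?invr_ge0 ?(ltW qR)// invrK.
  have := ler_wpM2l (ler0n R n) cp; lra.
split.
- apply: le_trans Hb; apply: le_trans Hu.
  rewrite le_eqVlt; apply/orP; left; apply/eqP; congr pr; apply/seteqP.
  by split => t /=; rewrite /L LcountE /v (mulrCA _ (sigma ^- 2)) ler_pM2l.
- apply: le_trans Hb; apply: le_trans Hl.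
  rewrite le_eqVlt; apply/orP; left; apply/eqP; congr pr; apply/seteqP.
  by split => t /=; rewrite /L LcountE /v (mulrCA _ (sigma ^- 2)) ler_pM2l.
Qed.

(* Moving [h] by the factor [lam] changes [w h ^+ 2] by about 9 / 4, which beats
   the factors 3 / 2 and 1 / 2 lost on the count of visits. *)
Let lam : R := (3 / 2) `^ s^-1.

Let lam_gt1 : 1 < lam.
Proof.
rewrite [ltLHS](_ : 1 = 1 `^ s^-1); last by rewrite powR1.
by rewrite gt0_ltr_powR ?invr_gt0 ?nnegrE//; lra.
Qed.

Let lam0 : 0 < lam. Proof. exact: lt_trans lam_gt1. Qed.

Let lamE : lam `^ s = 3 / 2.
Proof. by rewrite /lam -powRrM mulVf ?gt_eqF// powRr1//; lra. Qed.

Let near0_rate_up : \forall h \near (0:R)^'+, 29 / 20 * w h <= w (lam * h) <= 8 / 5 * w h.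
Proof.
have [_ _ /(_ _ lam0) H] := rate_rv; rewrite lamE in H.
near=> h; have hp : 0 < h by near: h; exact: nbhs_right_gt.
have wh := w_gt0 hp.
apply/andP; split; [rewrite -ler_pdivlMr//|rewrite -ler_pdivrMr//]; near: h.
  by apply: (cvgr_ge _ H); lra.
by apply: (cvgr_le _ H); lra.
Unshelve. all: by end_near. Qed.

Let near0_rate_down : \forall h \near (0:R)^'+, 13 / 20 * w h <= w (lam^-1 * h) <= 17 / 25 * w h.
Proof.
have li : 0 < lam^-1 by rewrite invr_gt0.
have [_ _ /(_ _ li) H] := rate_rv.
have lE : lam^-1 `^ s = 2 / 3.
  have c32 : 0 <= 3 / 2 :> R by rewrite divr_ge0.
  by rewrite -(powR_inv1 (ltW lam0)) powRAC lamE powR_inv1// invf_div.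
rewrite lE in H.
near=> h; have hp : 0 < h by near: h; exact: nbhs_right_gt.
have wh := w_gt0 hp.
apply/andP; split; [rewrite -ler_pdivlMr//|rewrite -ler_pdivrMr//]; near: h.
  by apply: (cvgr_ge _ H); lra.
by apply: (cvgr_le _ H); lra.
Unshelve. all: by end_near. Qed.

(** Half of the limit of [p (lam^-1 * (lam^-1 * h)) / p h]. *)
Let c0 : R := (lam^-1 * lam^-1) `^ (tau + 1) / 2.

Let c0_gt0 : 0 < c0.
Proof. by rewrite divr_gt0 ?powR_gt0 ?mulr_gt0 ?invr_gt0. Qed.

Let near0_mass : \forall h \near (0:R)^'+, c0 * p h <= p (lam^-1 * (lam^-1 * h)).
Proof.
have li : 0 < lam^-1 * lam^-1 by rewrite mulr_gt0 ?invr_gt0.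
have [_ _ /(_ _ li) H] := ball_mass_rv.
near=> h; have hp : 0 < h by near: h; exact: nbhs_right_gt.
rewrite -ler_pdivlMr ?p_gt0// mulrA; near: h.
apply: (cvgr_ge _ H); rewrite /c0; have := powR_gt0 (tau + 1) li; lra.
Unshelve. all: by end_near. Qed.

(** Two steps down: the first leaves the admissible set, which gives a strict inequality at
    [lam^-1 * hw n], and the second gains the factor on [w ^+ 2]. One step up suffices, as [hw n] is
    itself admissible. *)
Let h1 n := lam^-1 * (lam^-1 * hw n).
Let h2 n := lam * hw n.

Let bandwidth_close : \forall n \near \oo,
  [/\ 0 < h1 n <= h0, 0 < h2 n <= h0, h1 n <= h2 n,
      c0 / Num.max 1 (sigma ^- 2) * E n%:R^-1 <= p (h1 n) &
      forall t, Om n t -> L n (h1 n) t < 3 / 2 * v n (h1 n) ->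
        2^-1 * v n (h2 n) < L n (h2 n) t -> w (hw n) / 4 <= w (Hw n t) <= 4 * w (hw n)].
Proof.
have li0 : 0 < lam^-1 by rewrite invr_gt0.
have li1 : lam^-1 < 1 by rewrite invf_lt1.
have max0 : 0 < Num.max 1 (sigma ^- 2) by rewrite lt_max ltr01.
have s20 : 0 < sigma ^- 2 by rewrite invr_gt0 exprn_gt0.
have [hs0 _ _ _] := window.
have near0_le (k : R) : 0 < k -> \forall h \near (0:R)^'+, h <= k by move=> k0; exact: nbhs_right_le.
near=> n.
have n0 : (0 < n)%N by near: n; exact: nbhs_infty_gt.
have [/andP[hwp hwh0] iff] : 0 < hw n <= h0 /\
    forall h, 0 < h <= h0 -> (hw n <= h) = (psi b h0 h <= v n h * w h ^+ 2).
  by near: n; exact: mean_bandwidth_near.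
have /andP[wu1 wu2] : 29 / 20 * w (hw n) <= w (lam * hw n) <= 8 / 5 * w (hw n).
  by near: n; exact: (mean_bandwidth_small near0_rate_up).
have /andP[wd1 wd2] : 13 / 20 * w (hw n) <= w (lam^-1 * hw n) <= 17 / 25 * w (hw n).
  by near: n; exact: (mean_bandwidth_small near0_rate_down).
have /andP[we1 we2] : 13 / 20 * w (lam^-1 * hw n) <= w (lam^-1 * (lam^-1 * hw n))
    <= 17 / 25 * w (lam^-1 * hw n).
  by near: n; exact: (mean_bandwidth_small (near0_scale li0 near0_rate_down)).
have pm : c0 * p (hw n) <= p (lam^-1 * (lam^-1 * hw n)).
  by near: n; exact: (mean_bandwidth_small near0_mass).
have hws : hw n <= hs by near: n; exact: (mean_bandwidth_small (near0_le _ hs0)).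
have h2h0 : lam * hw n <= h0.
  by near: n; exact: (mean_bandwidth_small (near0_scale lam0 (near0_le _ h00))).
have hwhw : 0 < hw n <= h0 by rewrite hwp.
have hd0 : 0 < lam^-1 * hw n by rewrite mulr_gt0.
have hdhw : lam^-1 * hw n < hw n by rewrite -[ltRHS]mul1r ltr_pM2r.
have h10 : 0 < h1 n by rewrite mulr_gt0.
have h1hd : h1 n < lam^-1 * hw n by rewrite -[ltRHS]mul1r ltr_pM2r.
have hwh2 : hw n < h2 n by rewrite -[ltLHS]mul1r ltr_pM2r.
have h1h2 : h1 n <= h2 n by lra.
have h1h0 : h1 n <= h0 by lra.
have h20 : 0 < h2 n by lra.
have Hpsi : psi b h0 (hw n) <= v n (hw n) * w (hw n) ^+ 2 by rewrite -iff.
have wh := w_gt0 hwp; have wh1 := w_gt0 h10; have wh2 := w_gt0 h20; have whd := w_gt0 hd0.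
have vmono h h' : 0 < h -> h <= h' -> h' <= h0 -> v n h <= v n h'.
  by move=> hp hh hh0; apply: ler_wpM2l; [exact: ltW|apply: ler_wpM2l => //; exact: pi].
have vp h : 0 < h -> 0 < v n h.
  by move=> hp; apply: mulr_gt0 => //; apply: mulr_gt0; [rewrite ltr0n|exact: p_gt0].
split; rewrite ?h10 ?h20//.
- apply: le_trans pm; rewrite -mulrA ler_wpM2l ?(ltW c0_gt0)// mulrC ler_pdivrMr// mulrC.
  exact: envelope_le_mass.
- move=> t Omt Lh1 Lh2.
  have [/andP[Hp Hh0] Hiff] := random_bandwidthP sigma0 b0 h00
    (fun h (hh : 0 < h <= h0) => w_gt0 (proj1 (andP hh))) wc wi Omt.
  rewrite -/(Hw n t) in Hp Hh0 Hiff.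
  have {}Hiff h : 0 < h <= h0 -> (Hw n t <= h) = (psi b h0 h <= L n h t * w h ^+ 2) by exact: Hiff.
  (* [(29 / 20) ^+ 2 / 2 > 1]: half of the mean count still makes [h2 n] admissible. *)
  have up : Hw n t <= h2 n.
    rewrite Hiff ?h20//.
    apply: le_trans (psi_antitone b0 hwp (ltW hwh2) h2h0) _.
    apply: le_trans Hpsi _.
    have v12 := vmono _ _ hwp (ltW hwh2) h2h0.
    have w2 : (29 / 20 * w (hw n)) ^+ 2 <= w (h2 n) ^+ 2.
      have w2p : 0 <= 29 / 20 * w (hw n) by lra.
      by rewrite ler_pXn2r ?nnegrE ?(ltW wh2)//; exact: wu1.
    have W0 := sqr_ge0 (w (hw n)); have V0 := vp _ hwp.
    have e1 := ler_wpM2r W0 v12.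
    have v20 := vp _ h20.
    have e2 := ler_wpM2l (ltW v20) w2.
    have e3 := ler_wpM2r (sqr_ge0 (w (h2 n))) (ltW Lh2).
    have e4 : 0 <= v n (h2 n) * w (hw n) ^+ 2 by rewrite mulr_ge0// ltW.
    rewrite exprMn in e2; lra.
  (* [3 / 2 * (17 / 25) ^+ 2 < 1]: even 3 / 2 times the mean count does not make [h1 n]
     admissible. *)
  have low : h1 n < Hw n t.
    rewrite ltNge Hiff ?h10// -ltNge.
    have Hd : v n (lam^-1 * hw n) * w (lam^-1 * hw n) ^+ 2 < psi b h0 (lam^-1 * hw n).
      by rewrite ltNge -iff ?hd0 -?ltNge//; lra.
    have hdh0 : lam^-1 * hw n <= h0 by lra.
    apply: lt_le_trans (psi_antitone b0 h10 (ltW h1hd) hdh0).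
    apply: le_lt_trans Hd.
    have v1d := vmono _ _ h10 (ltW h1hd) hdh0.
    have w2 : w (h1 n) ^+ 2 <= (17 / 25 * w (lam^-1 * hw n)) ^+ 2.
      have w2p : 0 <= 17 / 25 * w (lam^-1 * hw n) by lra.
      by rewrite ler_pXn2r ?nnegrE ?(ltW wh1)//; exact: we2.
    have v10 := vp _ h10.
    have e1 := ler_wpM2r (sqr_ge0 (w (h1 n))) (ltW Lh1).
    have e2 := ler_wpM2l (ltW v10) w2.
    have e3 := ler_wpM2r (sqr_ge0 (w (lam^-1 * hw n))) v1d.
    have e4 : 0 <= v n (h1 n) * w (lam^-1 * hw n) ^+ 2 by rewrite mulr_ge0 ?sqr_ge0// ltW.
    rewrite (exprMn 2 (17 / 25)) in e2; lra.
  (* The factor 4 is generous: [8 / 5 <= 4] above and [(13 / 20) ^+ 2 >= 1 / 4] below. *)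
  have := wi Hp up h2h0; have := wi h10 (ltW low) Hh0.
  rewrite /h1 /h2 => u1 u2; apply/andP; split; lra.
Unshelve. all: by end_near. Qed.

Let h0h0 : 0 < h0 <= h0. Proof. by rewrite h00 lexx. Qed.

Let measurable_L n h (Q : R -> bool) : measurable [set t | Q (L n h t)].
Proof. exact: (measurable_Lcount_event sigma n mX). Qed.

(** Eventually [v n h0 * w h0 ^+ 2 >= 2], so outside [Om n] the count at [h0] is below half of its
    mean. The ball of radius [h0] has at least the mass of the ball of radius [h1 n], so
    [deviation_small] applies. *)
Let Omega0C_small e : 0 < e -> \forall n \near \oo, pr P (~` Om n) <= e * phi n.
Proof.
move=> e0; pose c := c0 / Num.max 1 (sigma ^- 2).
have cp : 0 < c by rewrite divr_gt0 ?c0_gt0// lt_max ltr01.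
near=> n.
have dev : forall h, 0 < h <= h0 -> c * E n%:R^-1 <= p h ->
    pr P [set t | 3 / 2 * v n h <= L n h t] <= e * phi n /\
    pr P [set t | L n h t <= 2^-1 * v n h] <= e * phi n.
  by near: n; exact: deviation_small.
have [/andP[h10 h1h0] _ _ ce _] : [/\ 0 < h1 n <= h0, 0 < h2 n <= h0, h1 n <= h2 n,
      c * E n%:R^-1 <= p (h1 n) &
      forall t, Om n t -> L n (h1 n) t < 3 / 2 * v n (h1 n) ->
        2^-1 * v n (h2 n) < L n (h2 n) t -> w (hw n) / 4 <= w (Hw n t) <= 4 * w (hw n)].
  by near: n; exact: bandwidth_close.
have v2 : 2 <= v n h0 * w h0 ^+ 2 by near: n; exact: v_large.
have [_] := dev h0 h0h0 (le_trans ce (pi h10 h1h0 (lexx _))).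
apply: le_trans; apply: pr_le; [apply: measurableC| |].
- apply: (measurable_Omega0 n mX) => //.
  by move=> h /andP[/w_gt0].
- exact: (measurable_L n h0 (fun l => l <= 2^-1 * v n h0)).
rewrite /Om Omega0E//; last by move=> h /andP[/w_gt0].
move=> t /= /negP; rewrite -ltNge => H.
rewrite leNgt; apply/negP => H2.
have := ler_wpM2r (sqr_ge0 (w h0)) (ltW H2); rewrite -/(L n h0 t) in H; lra.
Unshelve. all: by end_near. Qed.

Lemma bandwidth_comparison : \forall n \near \oo,
  ((1 - phi n)%:E <= P ([set t | (w (hw n) / 4 <= w (Hw n t) <= 4 * w (hw n))%R] `&` Om n))%E.
Proof.
pose c := c0 / Num.max 1 (sigma ^- 2).
have cp : 0 < c by rewrite divr_gt0 ?c0_gt0// lt_max ltr01.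
(* One third for each bad event: the complement of [Om n], too many visits at [h1 n], too few at
   [h2 n]. *)
have e0 : 0 < 3^-1 :> R by rewrite invr_gt0.
near=> n.
have dev : forall h, 0 < h <= h0 -> c * E n%:R^-1 <= p h ->
    pr P [set t | 3 / 2 * v n h <= L n h t] <= 3^-1 * phi n /\
    pr P [set t | L n h t <= 2^-1 * v n h] <= 3^-1 * phi n.
  by near: n; exact: deviation_small.
have [hh1 hh2 h12 ce close] : [/\ 0 < h1 n <= h0, 0 < h2 n <= h0, h1 n <= h2 n,
      c * E n%:R^-1 <= p (h1 n) &
      forall t, Om n t -> L n (h1 n) t < 3 / 2 * v n (h1 n) ->
        2^-1 * v n (h2 n) < L n (h2 n) t -> w (hw n) / 4 <= w (Hw n t) <= 4 * w (hw n)].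
  by near: n; exact: bandwidth_close.
have POm : pr P (~` Om n) <= 3^-1 * phi n by near: n; exact: Omega0C_small.
have [D1 _] := dev _ hh1 ce.
have /andP[h10 _] := hh1; have /andP[_ h2h0] := hh2.
have [_ D2] := dev _ hh2 (le_trans ce (pi h10 h12 h2h0)).
set A := [set t | _].
have w0' h : 0 < h <= h0 -> 0 < w h by move=> /andP[/w_gt0].
have mA : measurable (A `&` Om n) by exact: (measurable_random_bandwidth_event n mX).
have mOm : measurable (Om n) by exact: (measurable_Omega0 n mX).
rewrite prE// lee_fin lerBlDl -lerBlDr -(pr_setC P mA).
set B1 := [set t | 3 / 2 * v n (h1 n) <= L n (h1 n) t] in D1.
set B2 := [set t | L n (h2 n) t <= 2^-1 * v n (h2 n)] in D2.
have mB1 : measurable B1 by exact: (measurable_L n (h1 n) (fun l => 3 / 2 * v n (h1 n) <= l)).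
have mB2 : measurable B2 by exact: (measurable_L n (h2 n) (fun l => l <= 2^-1 * v n (h2 n))).
have mOC : measurable (~` Om n) by exact: measurableC.
have mU := measurableU _ _ mB1 mB2.
have sub : ~` (A `&` Om n) `<=` ~` Om n `|` (B1 `|` B2).
  move=> t Ht; apply: contrapT => /not_orP[/contrapT Omt /not_orP[/negP n1 /negP n2]].
  apply: Ht; split=> //; apply: close => //; by rewrite ltNge.
have := pr_le P (measurableC mA) (measurableU _ _ mOC mU) sub.
have := pr_setU_le P mOC mU; have := pr_setU_le P mB1 mB2; lra.
Unshelve. all: by end_near. Qed.

Lemma Omega0C_negligible : (fun n => fine (P (~` Om n))) =o_\oo phi.
Proof.
apply/eqoP => e e0; near=> n.
rewrite ger0_norm; last by exact: pr_ge0.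
apply: (@le_trans _ _ (e * phi n)).
  by near: n; exact: Omega0C_small.
by rewrite ler_wpM2l ?(ltW e0)// ler_norm.
Unshelve. all: by end_near. Qed.

End Instance.

Theorem proposition1 (R : realType) (m : mixing_type)
  (eta kappa tau s sigma : R) (lX lw : R -> R)
  (eta_gt0 : 0 < eta) (kappa_gt0 : 0 < kappa) (tau_ge : -1 <= tau)
  (s_gt0 : 0 < s) (s_le1 : s <= 1) (sigma_gt0 : 0 < sigma)
  (lX_sv : slowly_varying lX) (lw_sv : slowly_varying lw)
  (kappa_lt : m = arithmetic_mixing ->
     (kappa%:E < (2 * s)%:E / (tau + 1)%:E)%E) :
  exists (C : R) (l : R -> R), [/\ 0 < C, slowly_varying l &
  forall (d : nat) (disp : measure_display) (T : measurableType disp)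
    (P : probability T R) (F : nat -> set (set T))
    (X : nat -> T -> 'rV[R]_d) (Y eps : nat -> T -> R) (f : 'rV[R]_d -> R)
    (x : 'rV[R]_d) (mu gamma h0 b delta0 u0 : R)
    (disp' : measure_display) (T' : measurableType disp')
    (P' : probability T' R) (Z : int -> T' -> 'rV[R]_d)
    (mu_gt0 : 0 < mu) (gamma_gt0 : 0 < gamma) (h0_gt0 : 0 < h0)
    (b_gt0 : 0 < b) (delta0_gt0 : 0 < delta0) (u0_gt0 : 0 < u0)
    (F_filtration : filtration F)
    (X_adapted : forall k, measurable_wrt (F k) (@borel_rV R d) (X k))
    (Y_adapted : forall k, measurable_wrt (F k.+1) [set A : set R | measurable A] (Y k.+1))
    (Y_eq : forall k t, Y k.+1 t = f (X k t) + eps k.+1 t)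
    (eps_mart : martingale_increment P F eps)
    (eps_exp : forall k, condexp_ge0_le P (F k)
       (fun t => (expR (mu * eps k.+1 t ^+ 2 / sigma ^+ 2))%:E) gamma)
    (X_stat : strictly_stationary P X)
    (f_smooth : forall h : R, 0 <= h <= h0 ->
       (ereal_sup [set (`|f y - f x|)%:E | y in eball x h]
          <= (rate s lw h)%:E)%E)
    (w_incr : {in `[0, h0] &, {homo rate s lw : h h' / h <= h'}})
    (w_bounds : forall h : R, 0 <= h <= h0 ->
       delta0 * (h / h0) ^+ 2 <= rate s lw h <= u0)
    (PX_local : forall h : R, 0 < h <= h0 ->
       P (X 0%N @^-1` eball x h) = (h `^ (tau + 1) * lX h)%:E)
    (Z_ext : stationary_extension P X P' Z)
    (Z_mixing : mixing P' Z m eta kappa),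
  let w := rate s lw in
  let L := Lcount X x sigma in
  let Om n := Omega0 (L n) w h0 in
  let Hw n := random_bandwidth b h0 w (L n) in
  let hw n := mean_bandwidth P b h0 w (L n) in
  let phi := deviation m (delta m kappa tau s) C l in
  (\forall n \near \oo,
     ((1 - phi n)%:E <=
      P ([set t | (w (hw n) / 4 <= w (Hw n t) <= 4 * w (hw n))%R] `&` Om n))%E) /\
  (fun n => fine (P (~` Om n))) =o_\oo phi ].
Proof.
(* Every instance provides a monotone window, namely [h0]; if there is none, the
   claim is void. *)
have [[hs window]|nowindow] := pselect (exists hs, monotone_window tau s lX lw hs).
- exists 1, (slow_rate m kappa tau s lX lw hs); split => //; first exact: slow_rate_slow.
  move=> d disp T P F X Y eps f x mu gamma h0 b delta0 u0 disp' T' P' Z.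
  move=> _ _ h0_gt0 b_gt0 _ _ _ _ _ _ _ _ X_stat _ w_incr _ PX_local Z_ext Z_mixing.
  split.
  + exact: (bandwidth_comparison eta_gt0 kappa_gt0 tau_ge s_gt0 sigma_gt0 lX_sv lw_sv
      window h0_gt0 b_gt0 X_stat w_incr PX_local Z_ext Z_mixing).
  + exact: (Omega0C_negligible eta_gt0 kappa_gt0 tau_ge s_gt0 sigma_gt0 lX_sv lw_sv
      window h0_gt0 b_gt0 X_stat w_incr PX_local Z_ext Z_mixing).
(* [lX] merely serves as a slowly varying function at hand. *)
- exists 1, lX; split => //.
  move=> d disp T P F X Y eps f x mu gamma h0 b delta0 u0 disp' T' P' Z.
  move=> _ _ h0_gt0 _ _ _ _ _ _ _ _ _ X_stat _ w_incr _ PX_local _ _.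
  exfalso; apply: nowindow; exists h0.
  exact: (stationary_monotone_window h0_gt0 X_stat w_incr PX_local).
Qed.
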